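(* Let $\alpha\in(0,1)$ and let $\{X_n : n\ge 1\}$ be a sequence of i.i.d. non-arithmetic, non-negative random variables. Assume that there exist $t_0>0$ and a slowly varying (at infinity) function $L(\cdot)$ such that for all $t>t_0$ $$P(X_n>t)=\int_t^\infty s^{-\alpha-1}L(s)\,ds .$$ Let $A(t)$ and $C(t)$ be the age and the cycle-in-progress (total life) at time $t$ of the renewal process with inter-arrival times $X_1,X_2,\dots$, that is, with $S_0=0$, $S_n=X_1+\cdots+X_n$ for $n\ge 1$ and $N(t)=\max\{n\ge 0: S_n\le t\}$, let $A(t)=t-S_{N(t)}$ and $C(t)=S_{N(t)+1}-S_{N(t)}$. Let $U$ be a random variable uniformly distributed on $(0,1)$. Then $$\frac{A(t)}{C(t)}\Longrightarrow U^{1/\alpha}\qquad\text{as } t\to\infty,$$ where $\Longrightarrow$ denotes convergence in distribution.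
   Context: The residual life-time at time $t$ is $B(t)=S_{N(t)+1}-t$, and the cycle-in-progress is $C(t)=A(t)+B(t)$, which equals $S_{N(t)+1}-S_{N(t)}$. A function $L$ is slowly varying at infinity if it is measurable, eventually positive, and $L(cs)/L(s)\to 1$ as $s\to\infty$ for every $c>0$. A random variable is non-arithmetic if its distribution is not concentrated on a set of the form $\{kd : k\in\mathbb{Z}\}$ with $d>0$. *)

(* Defs.v *)
From HB Require Import structures.
From mathcomp Require Import all_boot all_order all_algebra finmap.
From mathcomp Require Import all_classical all_reals all_analysis measurable_realfun.

Set Implicit Arguments.
Unset Strict Implicit.
Unset Printing Implicit Defensive.

Import Order.TTheory GRing.Theory Num.Theory.
Import numFieldNormedType.Exports.

Local Open Scope classical_set_scope.
Local Open Scope ring_scope.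

Section laws.
Context (R : realType).

Definition identically_distributed d (T : measurableType d)
    (P : probability T R) (X : nat -> {RV P >-> R}) : Prop :=
  forall (i j : nat) (B : set R), measurable B ->
    distribution P (X i) B = distribution P (X j) B.

Definition mutually_independent d (T : measurableType d)
    (P : probability T R) (X : nat -> {RV P >-> R}) : Prop :=
  forall (J : {fset nat}) (B : nat -> set R),
    (forall i, i \in J -> measurable (B i)) ->
    P (\bigcap_(i in [set` J]) (X i @^-1` B i)) =
      (\prod_(i <- J) P (X i @^-1` B i))%E.

Definition non_arithmetic d (T : measurableType d)
    (P : probability T R) (Y : {RV P >-> R}) : Prop :=
  ~ exists2 h : R, 0 < h &
      distribution P Y (range (fun k : int => k%:~R * h)) = 1%E.

Definition uniform01 d (T : measurableType d)
    (P : probability T R) (U : {RV P >-> R}) : Prop :=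
  forall B : set R, measurable B ->
    distribution P U B = uniform_prob (@ltr01 R) B.

(* The limit may live on another probability space. *)
Definition cvg_in_distribution d d' (T : measurableType d)
    (T' : measurableType d') (P : probability T R) (Q : probability T' R)
    (I : Type) (F : set_system I)
    (Z : I -> {RV P >-> R}) (Y : {RV Q >-> R}) : Prop :=
  forall x : R, {for x, continuous (cdf Y)} ->
    cdf (Z i) x @[i --> F] --> cdf Y x.

(* Only the values of [L] at large arguments matter; measurability is required
   on the half-line only. *)
Definition slowly_varying (L : R -> R) : Prop :=
  [/\ measurable_fun (`]0, +oo[ : set R) L,
      \forall s \near +oo, 0 < L s
    & forall c : R, 0 < c -> L (c * s) / L s @[s --> +oo] --> (1 : R)].

End laws.

Arguments identically_distributed {R d T} P X.
Arguments mutually_independent {R d T} P X.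
Arguments non_arithmetic {R d T} P Y.
Arguments uniform01 {R d T} P U.
Arguments cvg_in_distribution {R d d' T T'} P Q {I} F Z Y.

Section rv_operations.
Context d (T : measurableType d) (R : realType).

Definition rv_div (Y Z : {mfun T >-> R}) : T -> R := fun w => Y w / Z w.

Definition rv_powR (Y : {mfun T >-> R}) (p : R) : T -> R := fun w => Y w `^ p.

Let measurable_invr : measurable_fun [set: R] (@GRing.inv R).
Proof.
have -> : [set: R] = [set 0] `|` ~` [set 0] by rewrite setUv.
apply/measurable_funU => //; first exact: measurableC.
split; first exact: measurable_fun_set1.
apply: open_continuous_measurable_fun.
  by apply/closed_openC/accessible_closed_set1/hausdorff_accessible/Rhausdorff.
move=> x; rewrite inE/= => /eqP x0.
exact: inv_continuous.
Qed.

Let measurable_rv_div Y Z : measurable_fun setT (rv_div Y Z).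
Proof.
apply: measurable_funM; first exact: measurable_funPT.
exact: (measurableT_comp measurable_invr (measurable_funPT Z)).
Qed.

HB.instance Definition _ Y Z :=
  isMeasurableFun.Build _ _ _ _ (rv_div Y Z) (measurable_rv_div Y Z).

Let measurable_rv_powR Y p : measurable_fun setT (rv_powR Y p).
Proof.
exact: (measurableT_comp (measurable_powR p) (measurable_funPT Y)).
Qed.

HB.instance Definition _ Y p :=
  isMeasurableFun.Build _ _ _ _ (rv_powR Y p) (measurable_rv_powR Y p).

End rv_operations.

(* The inter-arrival times are indexed from 0: [X 0] is the first one. *)
Section renewal.
Context d (T : measurableType d) (R : realType).
Variable X : nat -> {mfun T >-> R}.

Definition arrival (n : nat) : T -> R := fun w => \sum_(i < n) X i w.

(* [max {n | S_n <= t}], with value 0 where this maximum does not exist. *)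
Definition renewal_count (t : R) (w : T) : nat :=
  xget 0%N [set n | arrival n w <= t /\
                    forall m, arrival m w <= t -> (m <= n)%N].

Definition age (t : R) : T -> R :=
  fun w => t - arrival (renewal_count t w) w.

Definition cycle_in_progress (t : R) : T -> R :=
  fun w => arrival (renewal_count t w).+1 w - arrival (renewal_count t w) w.

Lemma measurable_arrival n : measurable_fun setT (arrival n).
Proof.
by apply: measurable_sum => i; exact: measurable_funPT.
Qed.

Let is_count t n := [set w | arrival n w <= t /\
                             forall m, arrival m w <= t -> (m <= n)%N].

Let measurable_is_count t n : measurable (is_count t n).
Proof.
have mle m : measurable [set w | arrival m w <= t].
  rewrite -[X in measurable X]setTI.
  have -> : [set w | arrival m w <= t] = arrival m @^-1` `]-oo, t].
    by apply/seteqP; split => w /=; rewrite in_itv.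
  exact: measurable_arrival.
have -> : is_count t n = [set w | arrival n w <= t] `&`
    \bigcap_(m in [set m | (n < m)%N]) ~` [set w | arrival m w <= t].
  apply/seteqP; split => w /= [Sn H]; split => // m.
  - by move=> nm /H; rewrite leqNgt nm.
  - by move=> Sm; rewrite leqNgt; apply/negP => /H.
apply: measurableI => //; apply: bigcap_measurable; first by exists n.+1 => /=.
by move=> m _; exact: measurableC.
Qed.

Lemma measurable_renewal_count t n :
  measurable [set w | renewal_count t w = n].
Proof.
have E m : [set w | renewal_count t w = m.+1] = is_count t m.+1.
  apply/seteqP; split => w /=; rewrite /renewal_count.
    by case: xgetP => [k _ Hk <-|].
  move=> Hm; apply: xget_unique => // k [Sk Hk]; apply/eqP.
  by rewrite eqn_leq; apply/andP; split; [exact: Hm.2|exact/Hk/Hm.1].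
case: n => [|n]; last by rewrite E.
have -> : [set w | renewal_count t w = 0%N] =
    ~` \bigcup_m [set w | renewal_count t w = m.+1].
  apply/seteqP; split => w /=; first by move=> E0 [m _] /=; rewrite E0.
  by case Em: (renewal_count t w) => [//|m] []; exists m.
by apply/measurableC/bigcup_measurable => m _; rewrite E.
Qed.

Let measurable_at_count t (f : nat -> T -> R) :
  (forall n, measurable_fun setT (f n)) ->
  measurable_fun setT (fun w => f (renewal_count t w) w).
Proof.
move=> mf _ B mB; rewrite setTI.
have -> : (fun w => f (renewal_count t w) w) @^-1` B =
    \bigcup_n ([set w | renewal_count t w = n] `&` f n @^-1` B).
  apply/seteqP; split => w /=; first by exists (renewal_count t w).
  by move=> [n _ [<-]].
apply: bigcup_measurable => n _; apply: measurableI.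
  exact: measurable_renewal_count.
by rewrite -[X in measurable X]setTI; exact: mf.
Qed.

Let measurable_age t : measurable_fun setT (age t).
Proof.
apply: (measurable_at_count t (f := fun n w => t - arrival n w)) => n.
by apply: measurable_funB => //; exact: measurable_arrival.
Qed.

HB.instance Definition _ t :=
  isMeasurableFun.Build _ _ _ _ (age t) (measurable_age t).

Let measurable_cycle t : measurable_fun setT (cycle_in_progress t).
Proof.
apply: (measurable_at_count t
  (f := fun n w => arrival n.+1 w - arrival n w)) => n.
by apply: measurable_funB; exact: measurable_arrival.
Qed.

HB.instance Definition _ t :=
  isMeasurableFun.Build _ _ _ _ (cycle_in_progress t) (measurable_cycle t).

End renewal.

(* Main.v *)
Require Import Defs.
From HB Require Import structures.
From mathcomp Require Import all_boot all_order all_algebra finmap.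
From mathcomp Require Import all_classical all_reals all_analysis.
From mathcomp Require Import measurable_realfun ring lra.

Set Implicit Arguments.
Unset Strict Implicit.
Unset Printing Implicit Defensive.

Import Order.TTheory GRing.Theory Num.Theory.
Import numFieldNormedType.Exports.

Local Open Scope classical_set_scope.
Local Open Scope ring_scope.

(** Why the theorem is true.  Write [S_n] for the arrival times, [F] for the
law of the inter-arrival times and [h a = P (X > a)] for [a >= 0], [h a = 0]
for [a < 0].  Almost surely [S_n <= t < S_n + X_n] for exactly one [n], and [S_n]
is independent of [X_n]; hence, for [0 < x < 1],

   [P (A t / C t <= x) = \sum_n E (k_x (t - S_n))]
   with [k_x a = P (X > a and a <= x * X)] for [a >= 0],

while the same sum with [h] in place of [k_x] is the total probability [1]
([probability_straddle], [probability_straddle_jump_set], [cdf_age_ratio]).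
For [a > 0] we have [k_x a = P (X >= a / x)], so that regular variation of the
tail gives [k_x a ~ x `^ alpha * h a] as [a --> +oo] ([ccdf_scale],
[ratio_law_squeeze]).
Therefore [P (A t / C t <= x)] differs from [x `^ alpha] by at most a small
constant plus [P (A t < M)], and the theorem follows as soon as the age escapes
to infinity in probability: [P (A t < M) --> 0] for every large [M].

That the age escapes is a consequence of the infinite mean
([young_prob_eventually_small]).  The function [p t = P (A t < M)] satisfies the
renewal equation [p t = \int p (t - s) dF s] for [t >= M].  Suppose that
[eta = limsup p > 0] and choose [t] large with [p t] very close to [eta].  As [p]
eventually stays below any level above [eta], the average [\int p (t - s) dF s]
can be that close to [eta] only if every window of [s] that carries a fixed
amount of [F]-mass contains a point with [p (t - s) > eta / 2]
([young_prob_window]).  Take such a point [s_j] in each of finitely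
many disjoint windows of length [M], separated by gaps of length [M].  The expected
number of arrivals in [(t - s_j - M, t - s_j]] is at least [p (t - s_j)], and an
arrival in [(t - s_j - M, t - s_j]] followed by a jump longer than [s_j + M]
forces [s_j <= A t < s_j + M]; these events exclude each other, so
[\sum_j P (X > s_j + M) * p (t - s_j) <= 1] ([young_prob_packing]).  But
[P (X > s)] decays no faster than [1 / s] ([ccdf_ge_inv]), so the sum exceeds
any bound when enough windows are used. *)

(** * Independence of an arrival time and the next jump *)

Section arrival_rv.
Context d (T : measurableType d) (R : realType) (X : nat -> {mfun T >-> R}).

HB.instance Definition _ n :=
  isMeasurableFun.Build _ _ _ _ (arrival X n) (measurable_arrival X n).

Lemma arrival0 w : arrival X 0 w = 0.
Proof. by rewrite /arrival big_ord0. Qed.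

Lemma arrivalS n w : arrival X n.+1 w = arrival X n w + X n w.
Proof. by rewrite /arrival big_ord_recr. Qed.

End arrival_rv.

Section independence.
Context d (T : measurableType d) (R : realType) (P : probability T R).
Variable X : nat -> {RV P >-> R}.
Hypothesis indepX : mutually_independent P X.
Local Open Scope ereal_scope.

Let future (J : {fset nat}) (B : nat -> set R) : set T :=
  \bigcap_(i in [set` J]) (X i @^-1` B i).

Let measurable_future (J : {fset nat}) B :
  (forall i, i \in J -> measurable (B i)) -> measurable (future J B).
Proof.
move=> mB; apply: fin_bigcap_measurable => [|i /= iJ].
  exact: finite_fset.
by apply: (measurable_funPTI (X i)); exact: mB.
Qed.

(** The events about the future are carried along in the induction on [k]:
passing from [S_k] to [S_k + X_k] requires the joint law of [S_k] and [X_k] on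
a given future event, and that law is determined by its values on rectangles,
which are values of the induction hypothesis at [k |` J]. *)
Lemma arrival_indep_future k (J : {fset nat}) (B : nat -> set R) (A : set R) :
  (forall i, i \in J -> (k <= i)%N) ->
  (forall i, i \in J -> measurable (B i)) -> measurable A ->
  P (arrival X k @^-1` A `&` \bigcap_(i in [set` J]) (X i @^-1` B i)) =
    P (arrival X k @^-1` A) * P (\bigcap_(i in [set` J]) (X i @^-1` B i)).
Proof.
rewrite -/(future J B).
elim: k => [|k IHk] in J B A *.
  move=> _ _ mA; have [A0|A0] := pselect (A 0%R).
    suff -> : arrival X 0 @^-1` A = setT.
      by rewrite setTI -[P [set: T]]/(P setT) probability_setT mul1e.
    by apply/seteqP; split => w //= _; rewrite arrival0.
  suff -> : arrival X 0 @^-1` A = set0 by rewrite set0I measure0 mul0e.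
  by apply/seteqP; split => w //=; rewrite arrival0.
move=> kJ mB mA.
have mE := measurable_future mB.
set E := future J B in mE *.
have pair_meas : measurable_fun setT (fun w => (arrival X k w, X k w)).
  by apply/measurable_fun_pairP; split => //; exact: measurable_arrival.
have [r rE] : exists r : {nonneg R}, r%:num%:E = P E.
  have r0 : (0 <= fine (P E))%R by rewrite fine_ge0.
  by exists (NngNum r0); rewrite /= fineK// fin_num_measure.
pose pair : {mfun T >-> (R * R)%type} :=
  HB.pack (fun w => (arrival X k w, X k w))
    (isMeasurableFun.Build _ _ _ _ _ pair_meas).
pose m1 := mscale r (distribution P (arrival X k)).
pose m2 := distribution P (X k).
have kJN : k \notin J by apply/negP => /kJ; rewrite ltnn.
pose B' (B1 : set R) i := if i == k then B1 else B i.
have mB' B1 i : measurable B1 -> i \in (k |` J)%fset -> measurable (B' B1 i).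
  by move=> mB1; rewrite !inE /B'; case: eqVneq => //= _; exact: mB.
have B'J B1 i : i \in J -> B' B1 i = B i.
  by move=> iJ; rewrite /B'; case: eqVneq => // ik; move: kJN; rewrite -ik iJ.
have consE B1 : X k @^-1` B1 `&` E = future (k |` J)%fset (B' B1).
  apply/seteqP; split => w /=.
    move=> [XB1 Ew] i /=; rewrite !inE /B'; case: eqVneq => [->//|_ /=].
    exact: Ew.
  move=> H; split; first by have := H k; rewrite /= /B' !inE eqxx; exact.
  by move=> i iJ; have := H i; rewrite /= !inE B'J// iJ orbT; exact.
have PXE B1 : measurable B1 -> P (X k @^-1` B1 `&` E) = P (X k @^-1` B1) * P E.
  move=> mB1; rewrite consE /E indepX; last by move=> i; exact: mB'.
  rewrite big_fsetU1//= {1}/B' eqxx /future indepX//; congr (_ * _).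
  by apply: eq_big_seq => i iJ; rewrite B'J.
have rect A1 B1 : measurable A1 -> measurable B1 ->
    P (arrival X k @^-1` A1 `&` (X k @^-1` B1 `&` E)) =
    P (arrival X k @^-1` A1) * (P (X k @^-1` B1) * P E).
  move=> mA1 mB1; rewrite -PXE// consE IHk//; last by move=> i; exact: mB'.
  by move=> i; rewrite !inE => /predU1P[->//|/kJ/ltnW].
have rect1 A1 B1 : measurable A1 -> measurable B1 ->
    P (arrival X k @^-1` A1 `&` X k @^-1` B1) =
    P (arrival X k @^-1` A1) * P (X k @^-1` B1).
  move=> mA1 mB1; have := IHk [fset k]%fset (fun=> B1) A1.
  rewrite /future set_fset1 bigcap_set1; apply => //.
  by move=> i; rewrite inE => /eqP ->.
have mD : measurable [set p : R * R | A (p.1 + p.2)%R].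
  have : measurable_fun setT (fun p : R * R => p.1 + p.2)%R.
    by apply: measurable_funD.
  by move=> /(_ measurableT _ mA); rewrite setTI.
(* Two measures that agree on rectangles: the joint law restricted to [E], and
   the joint law scaled by [P E]. *)
have E1 : (m1 \x m2) [set p : R * R | A (p.1 + p.2)%R] =
    pushforward (mrestr P mE) pair [set p : R * R | A (p.1 + p.2)%R].
  apply: product_measure_unique => // A1 B1 mA1 mB1.
  rewrite /pushforward /mrestr /= /m1 /mscale /= /m2 /distribution /pushforward.
  rewrite rE [P E * _]muleC -muleA [P E * _]muleC -rect//.
  by rewrite setIA.
have E2 : (m1 \x m2) [set p : R * R | A (p.1 + p.2)%R] =
    mscale r (distribution P pair) [set p : R * R | A (p.1 + p.2)%R].
  apply: product_measure_unique => // A1 B1 mA1 mB1.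
  transitivity (P E * P (arrival X k @^-1` A1 `&` X k @^-1` B1)).
    by rewrite -rE.
  by rewrite rect1// muleA -rE.
have E3 : pushforward (mrestr P mE) pair [set p : R * R | A (p.1 + p.2)%R] =
    P E * P (pair @^-1` [set p : R * R | A (p.1 + p.2)%R]).
  by rewrite -E1 E2 -rE.
have pairE : pair @^-1` [set p : R * R | A (p.1 + p.2)%R] = arrival X k.+1 @^-1` A.
  by apply/seteqP; split => w /=; rewrite arrivalS.
by rewrite muleC -pairE -E3.
Qed.

Hypothesis idX : identically_distributed P X.

(** The joint law of [S_n] and [X_n] is a product, so Tonelli lets one
integrate the jump out. *)
Lemma integral_arrival_step n (f : R * R -> \bar R) :
  measurable_fun setT f -> (forall p, 0 <= f p) ->
  \int[P]_w f (arrival X n w, X n w) =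
    \int[P]_w \int[distribution P (X 0%N)]_s f (arrival X n w, s).
Proof.
move=> mf f0.
have pair_meas : measurable_fun setT (fun w => (arrival X n w, X n w)).
  by apply/measurable_fun_pairP; split => //; exact: measurable_arrival.
pose pair : {mfun T >-> (R * R)%type} :=
  HB.pack (fun w => (arrival X n w, X n w))
    (isMeasurableFun.Build _ _ _ _ _ pair_meas).
transitivity (\int[distribution P pair]_p f p).
  by rewrite ge0_integral_distribution.
transitivity (\int[distribution P (arrival X n) \x distribution P (X 0%N)]_p f p).
  apply: eq_measure_integral => D mD _; apply/esym/product_measure_unique => //.
  move=> A B mA mB; rewrite [X in _ = _ * X](idX 0%N n mB).
  have := @arrival_indep_future n [fset n]%fset (fun=> B) A.
  rewrite set_fset1 bigcap_set1; apply => //.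
  by move=> i; rewrite inE => /eqP ->.
rewrite fubini_tonelli1//= ge0_integral_distribution//.
  exact: measurable_fun_fubini_tonelli_F.
by move=> y; apply: integral_ge0 => s _.
Qed.

End independence.

(** * The renewal potential *)

Section potential.
Context d (T : measurableType d) (R : realType) (P : probability T R).
Variable X : nat -> {RV P >-> R}.
Local Open Scope ereal_scope.

(** The convolution of [g] with the renewal measure [\sum_n law S_n]. *)
Definition potential (g : R -> \bar R) (t : R) : \bar R :=
  \sum_(n <oo) \int[P]_w g (t - arrival X n w)%R.

Implicit Types g h : R -> \bar R.

Let integral_shift_ge0 g t n : (forall a, 0 <= g a) ->
  0 <= \int[P]_w g (t - arrival X n w)%R.
Proof. by move=> g0; apply: integral_ge0 => w _. Qed.

Lemma potential_ge0 g t : (forall a, 0 <= g a) -> 0 <= potential g t.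
Proof. by move=> g0; apply: nneseries_ge0 => n _ _; exact: integral_shift_ge0. Qed.

Lemma measurable_shift_arrival g t n : measurable_fun setT g ->
  measurable_fun setT (fun w => g (t - arrival X n w)%R).
Proof.
move=> mg; apply: (measurableT_comp mg).
by apply: measurable_funB => //; exact: measurable_arrival.
Qed.

Lemma le_potential g h t : measurable_fun setT g -> measurable_fun setT h ->
  (forall a, 0 <= g a) -> (forall a, g a <= h a) ->
  potential g t <= potential h t.
Proof.
move=> mg mh g0 gh; apply: lee_nneseries => [n _ _|n _]; first exact: integral_shift_ge0.
by apply: ge0_le_integral => //; exact: measurable_shift_arrival.
Qed.

Lemma potentialD g h t : measurable_fun setT g -> measurable_fun setT h ->
  (forall a, 0 <= g a) -> (forall a, 0 <= h a) ->
  potential (fun a => g a + h a) t = potential g t + potential h t.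
Proof.
move=> mg mh g0 h0; rewrite /potential -nneseriesD; last 2 first.
- by move=> *; exact: integral_shift_ge0.
- by move=> *; exact: integral_shift_ge0.
apply: eq_eseriesr => n _; rewrite ge0_integralD//; exact: measurable_shift_arrival.
Qed.

Lemma potentialZ g (r : R) t : measurable_fun setT g ->
  (forall a, 0 <= g a) -> (0 <= r)%R ->
  potential (fun a => r%:E * g a) t = r%:E * potential g t.
Proof.
move=> mg g0 r0; rewrite /potential -nneseriesZl; last first.
  by move=> *; exact: integral_shift_ge0.
apply: eq_eseriesr => n _; rewrite ge0_integralZl_EFin//.
exact: measurable_shift_arrival.
Qed.

Lemma potential_sum (J : nat) (g : nat -> R -> \bar R) t :
  (forall j, measurable_fun setT (g j)) -> (forall j a, 0 <= g j a) ->
  potential (fun a => \sum_(j < J) g j a) t = \sum_(j < J) potential (g j) t.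
Proof.
move=> mg g0; rewrite /potential -nneseries_sum; last first.
  by move=> *; exact: integral_shift_ge0.
apply: eq_eseriesr => n _; rewrite ge0_integral_sum// => j.
exact: measurable_shift_arrival.
Qed.

Lemma potential_shift g t s : potential g (t - s) = potential (fun a => g (a - s)%R) t.
Proof.
by apply: eq_eseriesr => n _; apply: eq_integral => w _; rewrite addrAC.
Qed.

Lemma measurable_potential (g : R -> \bar R) : measurable_fun setT g ->
  (forall a, 0 <= g a) -> measurable_fun setT (potential g).
Proof.
move=> mg g0; apply: ge0_emeasurable_sum => [n t _ _|n _].
  exact: integral_ge0.
have mgs : measurable_fun setT (fun p : T * R => g (p.2 - arrival X n p.1)%R).
  apply: (measurableT_comp mg); apply: measurable_funB => //.
  by apply: measurableT_comp => //; exact: measurable_arrival.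
exact: (@measurable_fun_fubini_tonelli_G _ _ _ _ _ P (fun p => _) mgs).
Qed.

Hypothesis indepX : mutually_independent P X.
Hypothesis idX : identically_distributed P X.

(** Condition on the first jump.  Since the jumps are identically distributed,
it may be exchanged for the last one: [S_(n+1) = S_n + X_n] has the law of
[S_n] plus an independent copy of [X 0]. *)
Lemma renewal_equation g t : measurable_fun setT g -> (forall a, 0 <= g a) ->
  potential g t = g t + \int[distribution P (X 0%N)]_s potential g (t - s).
Proof.
move=> mg g0; rewrite /potential nneseries_recl//; last first.
  by move=> *; exact: integral_shift_ge0.
congr (_ + _).
  under eq_integral do rewrite arrival0 subr0.
  rewrite integral_cst// -[X in _ * X]/(P setT).
  by rewrite probability_setT mule1.
have mgs n : measurable_fun setT (fun p : T * R => g (t - p.2 - arrival X n p.1)%R).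
  apply: (measurableT_comp mg); apply: measurable_funB => //.
    by apply: measurable_funB.
  by apply: measurableT_comp => //; exact: measurable_arrival.
rewrite integral_nneseries//=; last 2 first.
- move=> n.
  exact: (@measurable_fun_fubini_tonelli_G _ _ _ _ _ P (fun p => _) (mgs n)).
- by move=> *; exact: integral_shift_ge0.
rewrite -[in LHS](@nneseries_addn _ _ 1%N); last first.
  by move=> *; exact: integral_shift_ge0.
apply: eq_eseriesr => n _.
rewrite -(@fubini_tonelli _ _ _ _ _ P (distribution P (X 0%N))
  (fun p => g (t - p.2 - arrival X n p.1)%R) (mgs n))//.
under eq_integral do rewrite addn1 arrivalS opprD addrA.
pose f (p : R * R) := g (t - p.1 - p.2)%R.
have mf : measurable_fun setT f.
  by apply: (measurableT_comp mg); do 2 apply: measurable_funB => //.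
rewrite -[LHS]/(\int[P]_w f (arrival X n w, X n w)).
have f0 p : 0 <= f p by exact: g0.
rewrite (integral_arrival_step indepX idX n mf f0).
by apply: eq_integral => w _; apply: eq_integral => s _; rewrite /f /= addrAC.
Qed.

End potential.

(** * Events on the jump that straddles a given time *)

Section straddle.
Context d (T : measurableType d) (R : realType) (P : probability T R).
Variable X : nat -> {RV P >-> R}.
Hypothesis indepX : mutually_independent P X.
Hypothesis idX : identically_distributed P X.
Hypothesis X_ge0 : forall n, {ae P, forall w, 0 <= X n w}.
Local Open Scope ereal_scope.

Lemma probability_setI1 (A Z : set T) : measurable A -> measurable Z ->
  P Z = 1 -> P (A `&` Z) = P A.
Proof.
move=> mA mZ PZ.
have mD : measurable (A `\` Z) by exact: measurableD.
have PD : P (A `\` Z) = 0.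
  apply/eqP; rewrite eq_le measure_ge0 andbT.
  apply: (@le_trans _ _ (P (~` Z))).
    by apply: le_measure; rewrite ?inE//; exact: measurableC.
  by rewrite probability_setC// PZ subee.
rewrite [in RHS](measureDI _ mA mZ).
by rewrite [X in X + _](_ : _ = 0) ?add0e.
Qed.

Definition nonneg_jumps : set T := [set w | forall n, (0 <= X n w)%R].

Lemma measurable_nonneg_jumps : measurable nonneg_jumps.
Proof.
have -> : nonneg_jumps = \bigcap_n (X n @^-1` `[0%R, +oo[).
  apply/seteqP; split => w /= H n.
    by move=> _ /=; rewrite in_itv/= andbT.
  by have := H n Logic.I; rewrite /= in_itv/= andbT.
by apply: bigcap_measurable => // n _; exact: measurable_funPTI.
Qed.

Lemma probability_nonneg_jumps : P nonneg_jumps = 1.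
Proof.
have [N [mN N0 sN]] := ae_foralln X_ge0.
apply/eqP; rewrite eq_le; apply/andP; split.
  exact/probability_le1/measurable_nonneg_jumps.
have <- : P (~` N) = 1 by rewrite probability_setC// N0 sube0.
apply: le_measure; rewrite ?inE; [exact: measurableC|exact: measurable_nonneg_jumps|].
by move=> w Nw; apply: contrapT => Gw; exact/Nw/sN.
Qed.

Lemma arrival_nondecreasing w : nonneg_jumps w ->
  {homo (fun n => arrival X n w) : m n / (m <= n)%N >-> (m <= n)%R}.
Proof.
move=> Gw; apply: homo_leq => [//|y x z|n]; first exact: le_trans.
by rewrite arrivalS lerDl.
Qed.

(** [D] constrains the pair of the time elapsed since the [n]-th arrival and
the length of the next jump; for [D] inside [0 <= a < z] at most one [n]
contributes, namely the index of the jump that straddles [t]. *)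
Definition straddle (D : set (R * R)) (t : R) : set T :=
  \bigcup_n [set w | D (t - arrival X n w, X n w)%R].

Lemma straddle_unique t w m n : nonneg_jumps w ->
  (0 <= t - arrival X m w < X m w)%R -> (0 <= t - arrival X n w < X n w)%R ->
  m = n.
Proof.
move=> Gw; wlog mn : m n / (m <= n)%N.
  move=> H Hm Hn; have [mn|nm] := leP m n; first exact: H.
  by apply/esym; apply: H => //; exact: ltnW.
rewrite !ltrBlDl -!arrivalS !subr_ge0 => /andP[_ tm] /andP[tn _].
apply/eqP; rewrite eqn_leq mn/= leqNgt; apply/negP => mn1.
have := lt_le_trans tm (arrival_nondecreasing Gw mn1).
by rewrite ltNge tn.
Qed.

Let measurable_straddle_n (D : set (R * R)) t n : measurable D ->
  measurable [set w | D (t - arrival X n w, X n w)%R].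
Proof.
move=> mD.
have mf : measurable_fun setT (fun w => (t - arrival X n w, X n w))%R.
  apply/measurable_fun_pairP; split => //.
  by apply: measurable_funB => //; exact: measurable_arrival.
by have := mf measurableT _ mD; rewrite setTI.
Qed.

Lemma measurable_straddle (D : set (R * R)) t : measurable D -> measurable (straddle D t).
Proof. by move=> mD; apply: bigcup_measurable => n _; exact: measurable_straddle_n. Qed.

(** On [nonneg_jumps] the events indexed by [n] are disjoint, so the probability
is a series; each term integrates, over the law of [S_n], the
probability that an independent jump completes the elapsed time to a
point of [D]. *)
Lemma probability_straddle (D : set (R * R)) t : measurable D ->
  (forall p, D p -> (0 <= p.1 < p.2)%R) ->
  P (straddle D t) =
    potential X (fun a => distribution P (X 0%N) (xsection D a)) t.
Proof.
move=> mD Dlt.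
have mS n := measurable_straddle_n t n mD.
have mSG n : measurable ([set w | D (t - arrival X n w, X n w)%R] `&` nonneg_jumps).
  by apply: measurableI => //; exact: measurable_nonneg_jumps.
rewrite -(@probability_setI1 _ nonneg_jumps); last 3 first.
- exact: measurable_straddle.
- exact: measurable_nonneg_jumps.
- exact: probability_nonneg_jumps.
rewrite /straddle setI_bigcupl measure_bigcup//; last first.
  apply/trivIsetP => m n _ _ mn; apply/seteqP; split => // w [[Dm Gw] [Dn _]].
  by move/eqP: mn; apply; exact: (straddle_unique Gw (Dlt _ Dm) (Dlt _ Dn)).
rewrite (eq_eseriesl (Q := xpredT)); last by move=> n; exact: mem_setT.
rewrite /potential; apply: eq_eseriesr => n _.
transitivity (P [set w | D (t - arrival X n w, X n w)%R]).
  apply: probability_setI1 => //; first exact: measurable_nonneg_jumps.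
  exact: probability_nonneg_jumps.
pose f (p : R * R) : \bar R := (\1_D (t - p.1, p.2)%R)%:E.
have mtD : measurable_fun setT (fun p : R * R => (t - p.1, p.2)%R).
  apply/measurable_fun_pairP; split => /=.
    by apply: measurable_funB => //; exact: measurable_fst.
  exact: measurable_snd.
have mf : measurable_fun setT f.
  apply/measurable_EFinP; apply: (measurableT_comp _ mtD).
  exact: measurable_indic.
have f0 p : 0 <= f p by rewrite lee_fin.
transitivity (\int[P]_w f (arrival X n w, X n w)).
  rewrite -[in LHS](setIT [set w | _]) -integral_indic//.
rewrite (integral_arrival_step indepX idX n mf f0).
apply: eq_integral => w _; rewrite /f /=.
have mx := @measurable_xsection _ _ _ _ D (t - arrival X n w)%R mD.
rewrite -[in RHS](setIT (xsection _ _)) -integral_indic//.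
apply: eq_integral => s _; rewrite !indicE; congr (_%:R%:E).
by rewrite mem_xsection.
Qed.

End straddle.

Section straddle_full.
Context d (T : measurableType d) (R : realType) (P : probability T R).
Variable X : nat -> {RV P >-> R}.
Hypothesis indepX : mutually_independent P X.
Hypothesis idX : identically_distributed P X.
Hypothesis X_ge0 : forall n, {ae P, forall w, 0 <= X n w}.
Hypothesis tail_gt0 : forall t : R, (0 < P [set w | (t < X 0%N w)%R])%E.
Local Open Scope ereal_scope.

(** Almost surely, if [S_n <= t] then each of the first [n] jumps is at most [t]. *)
Lemma arrival_le_geometric (t : R) n :
  P [set w | (arrival X n w <= t)%R] <= (fine (P [set w | (X 0%N w <= t)%R]) ^+ n)%:E.
Proof.
have leE (f : {mfun T >-> R}) : [set w | (f w <= t)%R] = f @^-1` `]-oo, t].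
  by apply/seteqP; split => w /=; rewrite in_itv.
have mle (f : {mfun T >-> R}) : measurable [set w | (f w <= t)%R].
  by rewrite leE; exact: measurable_funPTI.
elim: n => [|n IH]; first by rewrite expr0 probability_le1.
rewrite exprSr EFinM fineK; last by rewrite fin_num_measure.
apply: le_trans (lee_pmul _ _ IH (lexx _)) => //.
rewrite [X in _ <= _ * X](_ : _ = P [set w | (X n w <= t)%R]); last first.
  by rewrite !leE; exact: (idX 0%N n).
have <- : P ([set w | (arrival X n w <= t)%R] `&` [set w | (X n w <= t)%R]) =
   P [set w | (arrival X n w <= t)%R] * P [set w | (X n w <= t)%R].
  have := @arrival_indep_future _ _ _ _ _ indepX n [fset n]%fset
    (fun=> `]-oo, t]%classic) `]-oo, t]%classic.
  rewrite set_fset1 bigcap_set1 !leE; apply => //.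
  by move=> i; rewrite inE => /eqP ->.
rewrite -(@probability_setI1 _ _ _ _ _ (nonneg_jumps X)); last 3 first.
- exact: mle.
- exact: measurable_nonneg_jumps.
- exact: probability_nonneg_jumps.
apply: le_measure; rewrite ?inE.
- by apply: measurableI; [exact: mle|exact: measurable_nonneg_jumps].
- by apply: measurableI; exact: mle.
move=> w [/= + Gw]; rewrite arrivalS => St; split.
  by apply: le_trans St; rewrite lerDl.
apply: le_trans St; rewrite lerDr.
by rewrite -(arrival0 X w) arrival_nondecreasing.
Qed.

Definition jump_set : set (R * R) := [set p | (0 <= p.1 < p.2)%R].

Lemma measurable_jump_set : measurable jump_set.
Proof.
have mb : measurable_fun setT (fun p : R * R => (0 <= p.1)%R && (p.1 < p.2)%R).
  apply: measurable_and; first by apply: measurable_fun_ler.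
  by apply: measurable_fun_ltr.
by have := mb measurableT [set true] Logic.I; rewrite setTI.
Qed.

Definition ratio_set (x : R) : set (R * R) :=
  [set p | (0 <= p.1 < p.2)%R /\ (p.1 <= x * p.2)%R].

Lemma measurable_ratio_set x : measurable (ratio_set x).
Proof.
apply: measurableI; first exact: measurable_jump_set.
have mb : measurable_fun setT (fun p : R * R => (p.1 <= x * p.2)%R).
  by apply: measurable_fun_ler => //; exact: measurable_funM.
by have := mb measurableT [set true] Logic.I; rewrite setTI.
Qed.

Lemma not_straddle_arrival_le (t : R) n w : (0 <= t)%R -> nonneg_jumps X w ->
  ~ straddle X jump_set t w -> (arrival X n w <= t)%R.
Proof.
move=> t0 Gw Sw; elim: n => [|n IH]; first by rewrite arrival0.
rewrite leNgt; apply/negP => tS; apply: Sw; exists n => //=.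
by rewrite /jump_set/= subr_ge0 IH ltrBlDl -arrivalS.
Qed.

(** The walk passes [t] almost surely: a path that never straddles [t] stays
below [t], which has probability at most [q ^+ n] for every [n]. *)
Lemma probability_straddle_jump_set (t : R) : (0 <= t)%R ->
  P (straddle X jump_set t) = 1.
Proof.
move=> t0; set S := straddle _ _ _; pose q := fine (P [set w | (X 0%N w <= t)%R]).
have mS : measurable S by apply: measurable_straddle; exact: measurable_jump_set.
have mle (f : {mfun T >-> R}) : measurable [set w | (f w <= t)%R].
  have -> : [set w | (f w <= t)%R] = f @^-1` `]-oo, t].
    by apply/seteqP; split => w /=; rewrite in_itv.
  exact: measurable_funPTI.
have q0 : (0 <= q)%R by rewrite fine_ge0.
have q1 : (q < 1)%R.
  have qE : [set w | (X 0%N w <= t)%R] = ~` [set w | (t < X 0%N w)%R].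
    by apply/seteqP; split => w /=; rewrite leNgt => /negP.
  rewrite -lte_fin fineK ?fin_num_measure// qE probability_setC; last first.
    by rewrite -[X in measurable X]setCK -qE; apply: measurableC.
  rewrite lteBlDr ?fin_num_measure//.
    by rewrite lteDl// tail_gt0.
  by rewrite -[X in measurable X]setCK -qE; apply: measurableC.
have SCle n : (fine (P (~` S)) <= q ^+ n)%R.
  rewrite -lee_fin fineK; last by rewrite fin_num_measure//; exact: measurableC.
  apply: le_trans (arrival_le_geometric t n).
  rewrite -(@probability_setI1 _ _ _ _ (~` S) (nonneg_jumps X)); last 3 first.
  - exact: measurableC.
  - exact: measurable_nonneg_jumps.
  - exact: probability_nonneg_jumps.
  apply: le_measure; rewrite ?inE.
  - by apply: measurableI; [exact: measurableC|exact: measurable_nonneg_jumps].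
  - exact: mle.
  by move=> w [Sw Gw] /=; exact: not_straddle_arrival_le.
have SC0 : fine (P (~` S)) = 0%R.
  apply/eqP; rewrite eq_le fine_ge0 ?andbT// leNgt; apply/negP => SC.
  have qn1 : (`|q| < 1)%R by rewrite ger0_norm.
  have [n _ /(_ n (leqnn n))] := cvgr_lt _ (cvg_expr qn1) _ SC.
  by rewrite ltNge SCle.
have : P (~` S) = 0 by rewrite -[LHS]fineK ?SC0// fin_num_measure//; exact: measurableC.
rewrite probability_setC// => /eqP; rewrite sube_eq ?fin_num_measure//.
by rewrite add0e => /eqP.
Qed.

Lemma renewal_count_straddle t n w : nonneg_jumps X w ->
  jump_set (t - arrival X n w, X n w)%R -> renewal_count X t w = n.
Proof.
move=> Gw /andP[/= tn nt]; rewrite subr_ge0 in tn; rewrite ltrBlDl -arrivalS in nt.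
rewrite /renewal_count; apply: xget_unique => /=.
  split=> // m mt; rewrite leqNgt; apply/negP => nm.
  have := lt_le_trans nt (arrival_nondecreasing Gw nm).
  by rewrite ltNge mt.
move=> k [kt Hk]; apply/eqP; rewrite eqn_leq Hk// andbT leqNgt; apply/negP => nk.
have := lt_le_trans nt (arrival_nondecreasing Gw nk).
by rewrite ltNge kt.
Qed.

(** Almost surely the straddling index is [renewal_count], the elapsed time is
the age, and the jump is the cycle in progress. *)
Lemma cdf_age_ratio (x t : R) : (0 <= t)%R ->
  cdf (rv_div (age X t) (cycle_in_progress X t) : {RV P >-> R}) x =
  P (straddle X (ratio_set x) t).
Proof.
move=> t0.
pose S := straddle X jump_set t.
have mS : measurable S by apply: measurable_straddle; exact: measurable_jump_set.
have mZ : measurable (S `&` nonneg_jumps X).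
  by apply: measurableI => //; exact: measurable_nonneg_jumps.
have PZ : P (S `&` nonneg_jumps X) = 1.
  rewrite probability_setI1//; first exact: probability_straddle_jump_set.
    exact: measurable_nonneg_jumps.
  exact: probability_nonneg_jumps.
rewrite /cdf /distribution /pushforward.
rewrite -[LHS](probability_setI1 _ mZ PZ)//; last exact: measurable_funPTI.
rewrite -[RHS](probability_setI1 _ mZ PZ)//; last first.
  by apply: measurable_straddle; exact: measurable_ratio_set.
congr (P _); apply/seteqP; split => w /=.
- move=> [+ [[n _ /= Jn] Gw]]; have cE := renewal_count_straddle Gw Jn.
  rewrite in_itv/= /rv_div /= /age /cycle_in_progress cE arrivalS addrAC subrr add0r.
  have Xn0 : (0 < X n w)%R by case/andP: Jn => /= h1 h2; exact: le_lt_trans h2.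
  rewrite ler_pdivrMr// => H; split; last by split => //; exists n.
  by exists n.
- move=> [[n _ /= [Jn H]] [_ Gw]]; have cE := renewal_count_straddle Gw Jn.
  have Xn0 : (0 < X n w)%R by case/andP: Jn => /= h1 h2; exact: le_lt_trans h2.
  split; last by split => //; exists n.
  rewrite in_itv/= /rv_div /= /age /cycle_in_progress cE arrivalS addrAC subrr add0r.
  by rewrite ler_pdivrMr.
Qed.

End straddle_full.

(** * The age escapes to infinity *)

Section age_escapes.
Context d (T : measurableType d) (R : realType) (P : probability T R).
Variable X : nat -> {RV P >-> R}.
Hypothesis indepX : mutually_independent P X.
Hypothesis idX : identically_distributed P X.
Hypothesis X_ge0 : forall n, {ae P, forall w, 0 <= X n w}.
Local Notation law := (distribution P (X 0%N)).
Local Open Scope ereal_scope.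

Definition young_set (M : R) : set (R * R) :=
  [set p | (0 <= p.1 < p.2)%R /\ (p.1 < M)%R].

Lemma measurable_young_set M : measurable (young_set M).
Proof.
apply: measurableI; first exact: measurable_jump_set.
have mb : measurable_fun setT (fun p : R * R => (p.1 < M)%R).
  by apply: measurable_fun_ltr.
by have := mb measurableT [set true] Logic.I; rewrite setTI.
Qed.

Lemma law_xsection_jump_set a : (0 <= a)%R ->
  law (xsection (@jump_set R) a) = ccdf (X 0%N) a.
Proof.
move=> a0; congr (law _); apply/seteqP; split => z.
  by rewrite /xsection/= inE /jump_set/= in_itv/= andbT => /andP[].
by rewrite /xsection/= inE /jump_set/= in_itv/= andbT a0.
Qed.

Lemma law_xsection_young_set M a : law (xsection (young_set M) a) =
  if (0 <= a < M)%R then ccdf (X 0%N) a else 0.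
Proof.
case: ifPn => [/andP[a0 aM]|aM].
  congr (law _); apply/seteqP; split => z.
    by rewrite /xsection/= inE /young_set/= in_itv/= andbT => -[/andP[]].
  by rewrite /xsection/= inE /young_set/= in_itv/= andbT a0 aM.
rewrite [X in law X](_ : _ = set0) ?measure0//.
apply/seteqP; split => z //; rewrite /xsection/= inE => -[/= /andP[a0 _] aM'].
by move: aM; rewrite a0 aM'.
Qed.

Variable M : R.

(** The probability that the age at time [t] is less than [M]. *)
Definition young_prob (t : R) : \bar R :=
  potential X (fun a => law (xsection (young_set M) a)) t.

Let measurable_young : measurable_fun setT (fun a => law (xsection (young_set M) a)).
Proof. exact: measurable_fun_xsection (measurable_young_set M). Qed.

Lemma young_prob_ge0 t : 0 <= young_prob t.
Proof. exact: potential_ge0. Qed.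

Lemma young_prob_le1 t : young_prob t <= 1.
Proof.
rewrite /young_prob -probability_straddle//; last by move=> p [].
- apply/probability_le1/measurable_straddle; exact: measurable_young_set.
- exact: measurable_young_set.
Qed.

Lemma young_probE t : young_prob t = (fine (young_prob t))%:E.
Proof.
rewrite fineK// ge0_fin_numE ?young_prob_ge0//.
by rewrite (le_lt_trans (young_prob_le1 t))// ltry.
Qed.

Lemma young_prob_renewal t : (M <= t)%R ->
  young_prob t = \int[law]_s young_prob (t - s).
Proof.
move=> Mt; rewrite /young_prob (renewal_equation indepX idX)//.
by rewrite law_xsection_young_set ltNge Mt andbF add0e.
Qed.

(** The gap of length [M] between consecutive windows keeps the intervals
from [s] to [s + M] disjoint, where [s] runs over one point in each window. *)
Definition window (j : nat) : set R :=
  [set` `](2 * j%:R + 1) * M, (2 * j%:R + 2) * M]%R].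

(** The [j]-th term is at most the probability that [s j <= A t < s j + M]; the
bound [3 * M * j.+1] is no less than the right end of the [j]-th window
plus [M].
At the level of the integrands, at most one term is nonzero at a given
elapsed time [a], and it is bounded by the tail at [a]. *)
Lemma young_prob_packing (J : nat) (s : nat -> R) (t : R) : (0 <= t)%R ->
  (forall j, (j < J)%N -> window j (s j)) ->
  \sum_(j < J) (ccdf (X 0%N) (3 * M * j.+1%:R)%R * young_prob (t - s j)%R) <= 1.
Proof.
move=> t0 sJ.
have winE j : (j < J)%N ->
    ((2 * j%:R + 1) * M < s j /\ s j <= (2 * j%:R + 2) * M)%R.
  by move=> /sJ; rewrite /window/= in_itv/= => /andP.
pose c (j : nat) := fine (ccdf (X 0%N) (3 * M * j.+1%:R)%R).
have c0 j : (0 <= c j)%R by rewrite fine_ge0.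
have cE j : ccdf (X 0%N) (3 * M * j.+1%:R)%R = (c j)%:E.
  by rewrite /c fineK// fin_num_measure.
pose y a := law (xsection (young_set M) a).
have my : measurable_fun setT y by exact: measurable_young.
have mys j : measurable_fun setT (fun a : R => y (a - s j)%R).
  by apply: (measurableT_comp my); apply: measurable_funB.
have y0 a : 0 <= y a by [].
under eq_bigr do rewrite cE /young_prob -/y potential_shift -potentialZ//.
rewrite -(@potential_sum _ _ _ _ X J
  (fun j a => (c j)%:E * y (a - s j)%R)); last 2 first.
- by move=> j; apply: emeasurable_funM => //; exact: mys.
- by move=> j a; rewrite mule_ge0// lee_fin.
have mjump := @measurable_jump_set R.
apply: (@le_trans _ _ (potential X (fun a => law (xsection (@jump_set R) a)) t)); last first.
  rewrite -probability_straddle//.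
  by apply/probability_le1/measurable_straddle.
apply: le_potential.
- by apply: emeasurable_sum => j; apply: emeasurable_funM => //; exact: mys.
- exact: measurable_fun_xsection.
- by move=> a; apply: sume_ge0 => j _; rewrite mule_ge0// lee_fin.
move=> a.
have yle j : (j < J)%N -> (c j)%:E * y (a - s j)%R <= law (xsection (@jump_set R) a).
  move=> jJ; rewrite /y law_xsection_young_set; case: ifPn => [/andP[]|_].
    rewrite subr_ge0 => sa aM; have [s1 s2] := winE _ jJ.
    have j0 : (0 <= j%:R :> R)%R by [].
    have a0 : (0 <= a)%R by nra.
    rewrite law_xsection_jump_set// -cE.
    apply: (@le_trans _ _ (ccdf (X 0%N) (3 * M * j.+1%:R)%R)).
      by rewrite -[leRHS]mule1 lee_pmul// probability_le1.
    by apply: ccdf_nonincreasing; rewrite -natr1; nra.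
  by rewrite mule0.
have [/existsP[/= k /andP[k1 k2]]|/existsPn H] :=
    boolP [exists k : 'I_J, (0 <= a - s k < M)%R].
  rewrite (bigD1 k)//= big1 ?adde0; first exact: yle.
  move=> j jk; rewrite /y law_xsection_young_set ifF ?mule0//.
  apply/negP => /andP[j1 j2].
  have [s1 s2] := winE _ (ltn_ord k); have [s3 s4] := winE _ (ltn_ord j).
  have [jltk|kltj|/val_inj jk'] := ltngtP j k; last by rewrite jk' eqxx in jk.
    have : (j%:R + 1 <= k%:R :> R)%R by rewrite natr1 ler_nat.
    nra.
  have : (k%:R + 1 <= j%:R :> R)%R by rewrite natr1 ler_nat.
  nra.
rewrite big1// => j _; rewrite /y law_xsection_young_set.
by rewrite (negbTE (H j)) mule0.
Qed.

(** Each [s] in [I] lowers the average in the renewal equation by [b] below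
the level [a], which bounds [young_prob] after time [T0]; jumps longer than
[t - T0] are the only others that can raise it. *)
Lemma young_prob_window (I : set R) (t T0 a b : R) : measurable I ->
  (M <= t)%R -> (0 <= b <= a)%R ->
  (forall u, (T0 <= u)%R -> young_prob u <= a%:E) ->
  (forall s, I s -> young_prob (t - s) <= (a - b)%:E) ->
  young_prob t + b%:E * law I <= a%:E + ccdf (X 0%N) (t - T0).
Proof.
move=> mI Mt /andP[b0 ba] Ha Hb.
have mys : measurable_fun setT (fun s : R => young_prob (t - s)).
  apply: (measurableT_comp (measurable_potential X measurable_young _)) => //.
  by apply: measurable_funB.
have m1 (A : set R) : measurable A ->
    measurable_fun setT (fun s : R => (\1_A s)%:E : \bar R).
  by move=> mA; apply/measurable_EFinP; exact: measurable_indic.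
have yp s : 0 <= young_prob (t - s) by exact: young_prob_ge0.
have a0 : (0 <= a)%R by exact: le_trans ba.
have lawE A : measurable A -> law A = \int[law]_s (\1_A s)%:E.
  by move=> mA; rewrite integral_indic// setIT.
rewrite young_prob_renewal// lawE//.
rewrite -ge0_integralZl_EFin//; last exact: m1.
rewrite -ge0_integralD//; last 2 first.
- by move=> s _; rewrite mule_ge0// lee_fin.
- by apply: emeasurable_funM => //; exact: m1.
rewrite /ccdf lawE//.
have -> : a%:E = \int[law]_s a%:E.
  rewrite integral_cst// -[X in _ * X]/(law setT).
  by rewrite probability_setT mule1.
rewrite -ge0_integralD//; last exact: m1.
apply: ge0_le_integral => //.
- by move=> s _; rewrite adde_ge0 ?young_prob_ge0// mule_ge0// lee_fin.
- by apply: emeasurable_funD => //; apply: emeasurable_funM => //; exact: m1.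
- by apply: emeasurable_funD => //; exact: m1.
move=> s _; rewrite young_probE -EFinM -!EFinD lee_fin !indicE.
have := young_prob_le1 (t - s); have := Ha (t - s)%R; have := Hb s.
have := yp s.
rewrite young_probE !lee_fin; set y := fine _ => y0 yb ya y1.
have [sI|sI] := boolP (s \in I).
  have {}yb : (y <= a - b)%R by apply: yb; rewrite inE in sI.
  by case: (s \in _) => /=; lra.
have [sT|sT] := boolP (s \in _) => /=; first lra.
have : (y <= a)%R.
  apply: ya; move: sT; rewrite notin_setE /= in_itv/= andbT => /negP.
  by rewrite -leNgt; lra.
lra.
Qed.

Lemma ccdf_near_small (e : R) : (0 < e)%R ->
  exists u0, forall u, (u0 <= u)%R -> ccdf (X 0%N) u <= e%:E.
Proof.
move=> e0; have h := fine_cvg (cvg_ccdfy0 (X 0%N)).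
have [u0 [_ H]] := cvgr_lt _ (h _) _ e0.
exists (u0 + 1)%R => u u0u; rewrite -[leLHS]fineK ?fin_num_measure//.
by rewrite lee_fin ltW// H//; lra.
Qed.

Hypothesis window_charged : forall j, 0 < law (window j).
Hypothesis infinite_mean : forall B : R, exists J : nat,
  B%:E <= \sum_(j < J) ccdf (X 0%N) (3 * M * j.+1%:R)%R.

Let measurable_window j : measurable (window j).
Proof. exact: measurable_itv. Qed.

Lemma windows_charged J : exists2 k : R, (0 < k)%R &
  forall j, (j < J)%N -> k%:E <= law (window j).
Proof.
elim: J => [|J [k k0 IH]]; first by exists 1%R.
have lJ : (0 < fine (law (window J)))%R.
  apply: fine_gt0; rewrite window_charged/=.
  by rewrite (le_lt_trans (probability_le1 _ (measurable_window J))) ?ltry.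
exists (Num.min k (fine (law (window J))))%R; first by rewrite lt_min k0.
move=> j; rewrite ltnS leq_eqVlt => /predU1P[->|jJ].
  by rewrite -[leRHS]fineK ?fin_num_measure// lee_fin ge_min lexx orbT.
by apply: le_trans (IH j jJ); rewrite lee_fin ge_min lexx.
Qed.

(** Otherwise the superior limit [eta] is positive.  At a time [t] where
[young_prob] nearly attains it, [young_prob_window] yields a point of value
above [eta / 2] in each of the first [J] windows, and [young_prob_packing]
bounds the sum of the tails by [2 / eta]. *)
Lemma young_prob_eventually_small (e : R) : (0 < e)%R ->
  exists T0, forall t, (T0 <= t)%R -> young_prob t <= e%:E.
Proof.
move=> e0.
pose L := [set a : R | exists T0, forall t, (T0 <= t)%R -> young_prob t <= a%:E].
have L1 : L 1%R by exists 0%R => t _; exact: young_prob_le1.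
have lbL : lbound L 0%R.
  move=> a [T0 H]; rewrite -lee_fin; apply: le_trans (H T0 (lexx _)).
  exact: young_prob_ge0.
have infL : has_inf L by split; [exists 1%R|exists 0%R].
pose eta := inf L.
have eta_ub x : (eta < x)%R ->
    exists T0, forall t, (T0 <= t)%R -> young_prob t <= x%:E.
  rewrite -subr_gt0 => /inf_adherent/(_ infL)[a [T0 H] aeta].
  exists T0 => t /H ta; apply: le_trans ta _.
  by rewrite lee_fin ltW//; move: aeta; rewrite -/eta; lra.
have eta_lb x T0 : (x < eta)%R -> exists2 t, (T0 <= t)%R & x%:E < young_prob t.
  move=> xeta; apply: contrapT => H.
  have Lx : L x.
    exists T0 => t T0t; rewrite leNgt; apply/negP => xt; apply: H.
    by exists t.
  have := ge_inf infL.2 Lx; rewrite -/eta; lra.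
have [//|eta0] : (eta < e \/ e <= eta)%R by case: ltP; [left|right].
  exact: eta_ub.
exfalso.
have {e e0 eta0}eta0 : (0 < eta)%R by exact: lt_le_trans eta0.
have [J HJ] := infinite_mean (2 / eta + 1)%R.
have [k k0 Hk] := windows_charged J.
(* The mass [k] of a window costs [(eta / 2) * k], to be compared with the three
   errors of size [eps] made in [young_prob_window]. *)
pose eps : R := (Num.min (eta * k / 8) (eta / 4))%R.
have eps0 : (0 < eps)%R by rewrite lt_min; apply/andP; split; nra.
have [T0 HT0] := eta_ub (eta + eps)%R ltac:(lra).
have [u0 Hu0] := ccdf_near_small eps0.
pose tmin : R := (Num.max 0 (Num.max M (T0 + u0)))%R.
have [t tt Ht] := eta_lb (eta - eps)%R tmin ltac:(lra).
have t0 : (0 <= t)%R by apply: le_trans tt; rewrite le_max lexx.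
have tM : (M <= t)%R by apply: le_trans tt; rewrite !le_max lexx orbT.
have tu : (T0 + u0 <= t)%R by apply: le_trans tt; rewrite !le_max lexx !orbT.
have epsk : (eps <= eta * k / 8)%R by rewrite ge_min lexx.
have epse : (eps <= eta / 4)%R by rewrite ge_min lexx orbT.
have good j : exists s, (j < J)%N ->
    window j s /\ (eta / 2)%:E < young_prob (t - s)%R.
  have [jJ|jJ] := boolP (j < J)%N; last by exists 0%R.
  apply: contrapT => H.
  have Hs s : window j s -> young_prob (t - s) <= (eta + eps - (eta / 2 + eps))%:E.
    move=> ws; rewrite leNgt; apply/negP => sy; apply: H.
    exists s => _; split; first exact: ws.
    by apply: le_lt_trans sy; rewrite lee_fin; lra.
  have mW := measurable_window j.
  have be : (0 <= eta / 2 + eps <= eta + eps)%R by lra.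
  have := young_prob_window mW tM be HT0 Hs.
  rewrite leNgt => /negP; apply.
  apply: (@le_lt_trans _ _ ((eta + eps)%:E + eps%:E)).
    by rewrite leeD2l// Hu0//; lra.
  apply: (@lt_le_trans _ _ ((eta - eps)%:E + ((eta / 2) * k)%:E)).
    by rewrite -!EFinD lte_fin; nra.
  apply: leeD; first exact: ltW.
  rewrite EFinM; apply: lee_pmul; rewrite ?lee_fin; [lra|lra|lra|exact: Hk].
have [s Hs] := choice good.
have := young_prob_packing t0 (fun j jJ => (Hs j jJ).1).
rewrite leNgt => /negP; apply.
apply: (@lt_le_trans _ _ ((eta / 2)%:E * \sum_(j < J) ccdf (X 0%N) (3 * M * j.+1%:R)%R)).
  apply: (@lt_le_trans _ _ ((eta / 2)%:E * (2 / eta + 1)%:E)).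
    rewrite -EFinM lte_fin.
    have -> : (eta / 2 * (2 / eta + 1) = 1 + eta / 2)%R by field; lra.
    lra.
  by apply: lee_pmul => //; rewrite lee_fin ?addr_ge0 ?divr_ge0//; lra.
rewrite ge0_sume_distrr; last by move=> *; exact: measure_ge0.
apply: lee_sum => j _; rewrite muleC; apply: lee_pmul => //.
  by rewrite lee_fin; lra.
exact/ltW/(Hs j (ltn_ord j)).2.
Qed.

End age_escapes.

(** * Tails with a regularly varying density *)

Section scaling.
Context (R : realType).
Local Notation leb := (@lebesgue_measure R).
Local Open Scope ereal_scope.

(** The integrand is only assumed measurable, so the change of variable rests
on the scaling of Lebesgue measure, which is checked on half-open intervals. *)
Lemma ge0_integral_itvoy_scale (c s : R) (f : R -> \bar R) : (0 < c)%R ->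
  measurable_fun `](c * s)%R, +oo[ f -> (forall x, (c * s < x)%R -> 0 <= f x) ->
  \int[leb]_(x in `](c * s)%R, +oo[) f x =
    c%:E * \int[leb]_(x in `]s, +oo[) f (c * x)%R.
Proof.
move=> c0 mf f0.
have c0' : (0 <= c)%R by exact: ltW.
pose phi : R -> R := fun x => (c * x)%R.
have mphi : measurable_fun setT (phi : measurableTypeR R -> measurableTypeR R).
  exact: measurable_funM.
pose pf : {measure set (measurableTypeR R) -> \bar R} :=
  measure_function_pushforward__canonical__measure_function_Measure leb mphi.
have f0' : forall x, `](c * s)%R, +oo[%classic x -> 0 <= f x.
  by move=> x /=; rewrite in_itv/= andbT; exact: f0.
have preE : phi @^-1` `](c * s)%R, +oo[ = `]s, +oo[%classic.
  by apply/seteqP; split => x /=; rewrite !in_itv/= !andbT ltr_pM2l.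
transitivity (\int[mscale (NngNum c0') pf]_(x in `](c * s)%R, +oo[) f x).
  apply: eq_measure_integral => A mA _; apply: lebesgue_measure_unique => // _ [[a b] _ <-].
  transitivity (c%:E * leb `](a / c)%R, (b / c)%R]%classic).
    rewrite !lebesgue_measure_itv/= !lte_fin ltr_pM2r ?invr_gt0//.
    case: ifPn => _; last by rewrite mule0.
    by rewrite -!EFinB -EFinM -mulrBl mulrCA divff ?mulr1 ?gt_eqF.
  rewrite -[RHS]/(c%:E * leb (phi @^-1` `]a, b])); congr (_ * leb _).
  by apply/seteqP; split => x /=;
    rewrite !in_itv/= ltr_pdivrMr// ler_pdivlMr// /phi mulrC.
rewrite ge0_integral_mscale//.
congr (_ * _); rewrite ge0_integral_pushforward//; first by rewrite preE.
by move=> x; rewrite inE; exact: f0'.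
Qed.

End scaling.

Section regular_variation.
Context d (T : measurableType d) (R : realType) (P : probability T R).
Variables (Y : {RV P >-> R}) (alpha t0 : R) (L : R -> R).
Hypothesis svL : slowly_varying L.
Hypothesis tailY : forall t : R, t0 < t -> ccdf Y t =
  (\int[lebesgue_measure]_(s in `]t, +oo[) (s `^ (- alpha - 1) * L s)%:E)%E.
Local Notation leb := (@lebesgue_measure R).

Let density (s : R) := s `^ (- alpha - 1) * L s.

Let threshold : exists s1 : R, [/\ 0 < s1, t0 < s1 & forall s, s1 <= s -> 0 < density s].
Proof.
have [_ [M [_ HM]] _] := svL.
have le3 : [/\ 0 <= Num.max 0 (Num.max t0 M), t0 <= Num.max 0 (Num.max t0 M)
    & M <= Num.max 0 (Num.max t0 M)].
  by split; rewrite !le_max lexx ?orbT.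
have [h1 h2 h3] := le3; exists (Num.max 0 (Num.max t0 M) + 1); split; [lra|lra|].
move=> s hs; rewrite /density mulr_gt0//; first by rewrite powR_gt0; lra.
by apply: HM; lra.
Qed.

Let measurable_density (s : R) : 0 <= s ->
  measurable_fun `]s, +oo[ (fun x => (density x)%:E).
Proof.
move=> s0.
have m0 : measurable_fun (`]0, +oo[ : set R) (fun x => (density x)%:E).
  apply/measurable_EFinP; apply: measurable_funM; last by case: svL.
  by apply: measurable_funTS; exact: measurable_powR.
apply: (measurable_funS _ _ m0) => //.
by apply: subset_itvr; rewrite bnd_simp.
Qed.

(** Substituting [c * v] in the tail integral replaces the density by
[c * density (c * v)], whose ratio to [density v] is
[c `^ (- alpha) * (L (c * v) / L v)], and the last factor tends to [1]. *)
Lemma ccdf_scale (c e : R) : 0 < c -> 0 < e < 1 ->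
  exists s2, forall s, s2 <= s ->
    ((c `^ (- alpha) * (1 - e))%:E * ccdf Y s <= ccdf Y (c * s) /\
     ccdf Y (c * s) <= (c `^ (- alpha) * (1 + e))%:E * ccdf Y s)%E.
Proof.
move=> c0 /andP[e0 e1].
have [s1 [s10 t0s1 fpos]] := threshold.
have [_ _ /(_ c c0) Lc] := svL.
move/cvgrPdist_lt: Lc => /(_ e e0)[sc [_ Hsc]].
pose s2 := Num.max s1 (Num.max (s1 / c) (sc + 1)).
have h1 : s1 <= s2 by rewrite le_max lexx.
have h2 : s1 / c <= s2 by rewrite !le_max lexx orbT.
have h3 : sc + 1 <= s2 by rewrite !le_max lexx !orbT.
exists s2 => s s2s.
have s1s : s1 <= s by lra.
have s1cs : s1 <= c * s by rewrite mulrC -ler_pdivrMr//; lra.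
have cp : 0 < c `^ (- alpha) by exact: powR_gt0.
have dens x : s < x ->
    c `^ (- alpha) * (1 - e) * density x <= c * density (c * x) <=
    c `^ (- alpha) * (1 + e) * density x.
  move=> sx; have x0 : 0 < x by lra.
  have Lx : 0 < L x.
    have := fpos x ltac:(lra); rewrite /density pmulr_rgt0//; exact: powR_gt0.
  have := Hsc x ltac:(lra); rewrite /= ltr_norml => /andP[].
  rewrite ltrBrDl ltrBlDr => H1 H2.
  have E : c * density (c * x) =
      c `^ (- alpha) * (L (c * x) / L x) * density x.
    rewrite /density powRM ?(ltW c0) ?(ltW x0)//.
    rewrite [c `^ (- alpha - 1)]powRD; last by rewrite (gt_eqF c0) implybT.
    rewrite (powRN c 1) powRr1 ?(ltW c0)//.
    by field; rewrite !gt_eqF.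
  rewrite E !ler_pM2r ?fpos//; [|lra|lra].
  by rewrite !ler_pM2l//; apply/andP; split; lra.
have mdc : measurable_fun `]s, +oo[ (fun x => (density (c * x))%:E).
  apply: (measurable_comp (F := `]c * s, +oo[%classic)
    (f := fun y => (density y)%:E) (g := fun x => c * x)) => //.
  - move=> _ [x sx <-]; move: sx; rewrite /= in_itv/= andbT => sx.
    by rewrite in_itv/= andbT ltr_pM2l.
  - by apply: measurable_density; lra.
  - by apply: measurable_funTS; exact: measurable_funM.
have d0 x : s < x -> 0 <= density x by move=> sx; apply/ltW/fpos; lra.
have dc0 x : s < x -> 0 <= density (c * x).
  by move=> sx; apply/ltW/fpos; rewrite (le_trans s1cs)// ler_pM2l// ltW.
rewrite (tailY (t := s)); last by lra.
rewrite (tailY (t := c * s)); last by lra.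
rewrite ge0_integral_itvoy_scale//; last 2 first.
- by apply: measurable_density; lra.
- by move=> x csx; rewrite lee_fin; apply/ltW/fpos; lra.
have md : measurable_fun `]s, +oo[ (fun x => (density x)%:E).
  by apply: measurable_density; lra.
have in_s x : `]s, +oo[%classic x -> s < x by rewrite /= in_itv/= andbT.
have dE0 x : `]s, +oo[%classic x -> (0 <= (density x)%:E)%E.
  by move=> /in_s /d0; rewrite lee_fin.
have dcE0 x : `]s, +oo[%classic x -> (0 <= (density (c * x))%:E)%E.
  by move=> /in_s /dc0; rewrite lee_fin.
have k1 : 0 <= c `^ (- alpha) * (1 - e) by rewrite mulr_ge0; lra.
have k2 : 0 <= c `^ (- alpha) * (1 + e) by rewrite mulr_ge0; lra.
have cge0 : 0 <= c by lra.
rewrite -(ge0_integralZl_EFin leb (measurable_itv _) dE0 md k1).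
rewrite -(ge0_integralZl_EFin leb (measurable_itv _) dE0 md k2).
rewrite -(ge0_integralZl_EFin leb (measurable_itv _) dcE0 mdc cge0).
split; apply: ge0_le_integral => //.
- by move=> x /dE0 dx; rewrite mule_ge0.
- by apply: emeasurable_funM.
- by apply: emeasurable_funM.
- by move=> x /in_s /dens/andP[+ _]; rewrite -!EFinM lee_fin.
- by move=> x /dcE0 dx; rewrite mule_ge0.
- by apply: emeasurable_funM.
- by apply: emeasurable_funM.
- by move=> x /in_s /dens/andP[_]; rewrite -!EFinM lee_fin.
Qed.

(** The mass of the interval is the integral of a density that is eventually
positive. *)
Lemma ccdf_itv_charged : exists b0 : R, forall a b, b0 <= a -> a < b ->
  (0 < distribution P Y `]a, b])%E.
Proof.
have [s1 [s10 t0s1 fpos]] := threshold.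
exists s1 => a b s1a ab.
have disj : [disjoint `]a, b]%classic & `]b, +oo[%classic].
  by apply/disj_setPS => x [] /=; rewrite !in_itv/= andbT leNgt => /andP[_ /negP].
have abE : `]a, +oo[%classic = `]a, b]%classic `|` `]b, +oo[%classic :> set R.
  by rewrite -itv_bndbnd_setU// bnd_simp// ltW.
have mab : measurable_fun (`]a, b] `|` `]b, +oo[) (fun x => (density x)%:E).
  by rewrite -abE; apply: measurable_density; lra.
have dab x : (`]a, b]%classic `|` `]b, +oo[%classic) x -> (0 <= (density x)%:E)%E.
  by rewrite -abE /= in_itv/= andbT => ax; rewrite lee_fin; apply/ltW/fpos; lra.
have lawE : distribution P Y `]a, b]%classic =
    (\int[leb]_(x in `]a, b]) (density x)%:E)%E.
  have Eb := tailY (t := b) ltac:(lra).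
  have : ccdf Y a = (\int[leb]_(x in `]a, b]) (density x)%:E + ccdf Y b)%E.
    by rewrite Eb tailY ?abE ?ge0_integral_setU//; lra.
  rewrite {1}/ccdf abE measureU//; last first.
    by apply/disj_set2P.
  rewrite -/(ccdf Y b).
  have fb : ccdf Y b \is a fin_num by rewrite fin_num_measure.
  by move=> /(congr1 (fun z => z - ccdf Y b)%E); rewrite !addeK.
rewrite lawE lt0e; apply/andP; split; last first.
  apply: integral_ge0 => x xab; apply: dab; by left.
apply/eqP => I0.
have mab' : measurable_fun `]a, b] (fun x => (density x)%:E).
  apply: (measurable_funS _ _ mab) => //; exact: measurableU.
have : ae_eq leb `]a, b]%classic (fun x => (density x)%:E) (cst 0%E).
  apply/ae_eq_integral_abs => //; rewrite -I0; apply: eq_integral => x.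
  by rewrite inE => xab; rewrite gee0_abs//; apply: dab; left.
move=> [N [mN N0 sN]].
have : (leb `]a, b] <= leb N)%E.
  apply: le_measure; rewrite ?inE// => x xab; apply: sN => /= /(_ xab).
  move=> [] /eqP; rewrite gt_eqF// fpos//.
  by move: xab; rewrite /= in_itv/= => /andP[]; lra.
rewrite N0 lebesgue_measure_itv/= lte_fin ab -EFinB lee_fin subr_le0.
by rewrite leNgt ab.
Qed.

(** As [2 `^ (- alpha) > 1 / 2], doubling the argument of the tail eventually
loses a factor of at most [2]; iterating over dyadic scales gives decay no
faster than [1 / u]. *)
Lemma ccdf_ge_inv : alpha < 1 -> exists b k : R, [/\ 0 < b, 0 < k &
  forall u, b <= u -> ((k / u)%:E <= ccdf Y u)%E].
Proof.
move=> alpha1.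
have [b0 charged] := ccdf_itv_charged.
have p2 : 0 < (2 : R) `^ alpha by exact: powR_gt0.
have p2lt : (2 : R) `^ alpha < 2.
  rewrite -[ltRHS](@powRr1 _ 2)// /powR gt_eqF// ltr_expR ltr_pM2r//.
  by rewrite ln_gt0// ltr1n.
(* This error term makes the factor [2 `^ (- alpha) * (1 - e)] equal to [1 / 2]. *)
have [s2 Hs2] := @ccdf_scale 2 (1 - 2 `^ alpha / 2) ltac:(lra) ltac:(apply/andP; split; lra).
pose G u := fine (ccdf Y u).
have GE u : ccdf Y u = (G u)%:E by rewrite /G fineK// fin_num_measure.
have Gni u v : u <= v -> G v <= G u.
  by move=> uv; rewrite -lee_fin -!GE; exact: ccdf_nonincreasing.
have G2 u : s2 <= u -> G u / 2 <= G (2 * u).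
  move=> /Hs2[+ _]; rewrite !GE -EFinM lee_fin powRN.
  rewrite [X in X * _ <= _](_ : _ = 2^-1); first by rewrite mulrC.
  by field; rewrite gt_eqF.
pose b := Num.max 1 s2.
have b1 : 1 <= b by rewrite le_max lexx.
have bs2 : s2 <= b by rewrite le_max lexx orbT.
have G2b : 0 < G (2 * b).
  pose m := Num.max b0 (2 * b).
  have mb : 2 * b <= m by rewrite le_max lexx orbT.
  apply: lt_le_trans (Gni _ _ mb); rewrite -lte_fin -GE.
  apply: lt_le_trans (charged m (m + 1) _ _) _; rewrite ?le_max ?lexx ?ltrDl//.
  apply: le_measure; rewrite ?inE// => x /=; rewrite !in_itv/= andbT.
  by case/andP.
exists b, (b * G (2 * b)); split; [lra|by rewrite mulr_gt0//; lra|].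
have key n u : b <= u -> u <= 2 ^+ n * b -> b * G (2 * b) / u <= G u.
  elim: n u => [|n IH] u bu.
    rewrite expr0 mul1r => ub; have u0 : 0 < u by lra.
    rewrite ler_pdivrMr//.
    have := Gni u (2 * b) ltac:(lra); nra.
  move=> un; have u0 : 0 < u by lra.
  have [u2|u2] := leP u (2 * b).
    rewrite ler_pdivrMr//; have := Gni u (2 * b) u2; nra.
  have := IH (u / 2) ltac:(lra); rewrite exprS in un.
  have -> : u / 2 <= 2 ^+ n * b by lra.
  move=> /(_ isT) H; have := G2 (u / 2) ltac:(lra).
  rewrite (_ : 2 * (u / 2) = u); last by field.
  apply: le_trans; rewrite ler_pdivlMr//; apply: le_trans H.
  by rewrite le_eqVlt; apply/orP; left; apply/eqP; field; rewrite gt_eqF.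
move=> u bu; rewrite GE lee_fin.
pose n := Num.bound (u / b).
apply: (key n) => //; rewrite -ler_pdivrMr; last lra.
have : u / b < n%:R by apply: archi_boundP; rewrite divr_ge0; lra.
move=> /ltW/le_trans; apply.
by rewrite -natrX ler_nat ltnW// ltn_expl.
Qed.

Lemma ccdf_gt0 (t : R) : (0 < P [set w | (t < Y w)%R])%E.
Proof.
have [b0 charged] := ccdf_itv_charged.
pose m := Num.max b0 t.
have mb : t <= m by rewrite le_max lexx orbT.
have bm : b0 <= m by rewrite le_max lexx.
have tE : [set w | t < Y w] = Y @^-1` `]t, +oo[.
  by apply/seteqP; split => w /=; rewrite in_itv/= andbT.
apply: lt_le_trans (charged m (m + 1) bm _) _; first by rewrite ltrDl.
rewrite tE; apply: le_measure; rewrite ?inE//; [exact: measurable_funPTI..|].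
by move=> w /=; rewrite !in_itv/= andbT => /andP[mw _]; exact: le_lt_trans mw.
Qed.

(** The mean is infinite, by comparison with the harmonic series. *)
Lemma ccdf_series_dvg : alpha < 1 -> exists2 b : R, 0 < b & forall m B : R, b <= m ->
  exists J : nat, (B%:E <= \sum_(j < J) ccdf Y (m * j.+1%:R))%E.
Proof.
move=> /ccdf_ge_inv[b [k [b0 k0 H]]]; exists b => // m B bm.
have m0 : 0 < m by lra.
have [J HJ] : exists J, B * m / k <= series harmonic J.
  apply: contrapT => no; apply: (@dvg_harmonic R).
  apply: nondecreasing_is_cvgn.
    apply: nondecreasing_series => n _ _; exact: harmonic_ge0.
  exists (B * m / k) => _ [n _ <-]; rewrite leNgt; apply/negP => nn.
  by apply: no; exists n; exact: ltW.
exists J; apply: (@le_trans _ _ (\sum_(j < J) (k / (m * j.+1%:R))%:E)%E); last first.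
  apply: lee_sum => j _; apply: H; rewrite -[leLHS]mulr1 ler_pM//; [lra|].
  by rewrite ler1n.
rewrite sumEFin lee_fin.
have -> : \sum_(j < J) k / (m * j.+1%:R) = k / m * series harmonic J.
  rewrite /series/= big_mkord mulr_sumr; apply: eq_bigr => j _.
  by rewrite invfM mulrA.
by rewrite mulrC -ler_pdivrMr ?divr_gt0// invf_div mulrA.
Qed.

End regular_variation.

(** * Powers of a uniform variable *)

Section uniform_power.
Context d' (T' : measurableType d') (R : realType) (Q : probability T' R).
Variables (U : {RV Q >-> R}) (alpha : R).
Hypothesis alpha_gt0 : 0 < alpha.
Hypothesis unifU : uniform01 Q U.

Lemma cdf_uniform01_powR (x : R) : 0 <= x <= 1 ->
  cdf (rv_powR U alpha^-1 : {RV Q >-> R}) x = (x `^ alpha)%:E.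
Proof.
move=> /andP[x0 x1].
pose B : set R := (fun u => u `^ alpha^-1) @^-1` `]-oo, x].
have mB : measurable B.
  have := measurable_powR alpha^-1 measurableT (measurable_itv `]-oo, x]).
  by rewrite setTI.
transitivity (distribution Q U B); first by [].
have alpha_neq0 : alpha != 0 by rewrite gt_eqF.
have xa0 : 0 <= x `^ alpha by exact: powR_ge0.
have xa1 : x `^ alpha <= 1.
  have := @ge0_ler_powR R alpha (ltW alpha_gt0) x 1.
  by rewrite powR1; apply; rewrite ?nnegrE.
have BE : B `&` `[0, 1] = `[0, x `^ alpha]%classic.
  apply/seteqP; split => u /=; rewrite /B /= !in_itv/=.
    move=> [ux /andP[u0 u1]]; rewrite u0/=.
    rewrite -[leLHS](powRr1 u0) -(mulVf alpha_neq0) powRrM.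
    by rewrite ge0_ler_powR ?nnegrE ?powR_ge0// ltW.
  move=> /andP[u0 ux]; rewrite u0/= (le_trans ux xa1); split => //.
  rewrite -[leRHS](powRr1 x0) -(divff alpha_neq0) powRrM.
  by rewrite ge0_ler_powR ?nnegrE ?powR_ge0// invr_ge0 ltW.
rewrite unifU// /uniform_prob integral_uniform_pdf BE.
rewrite (eq_integral (fun=> 1%E)); last first.
  move=> u; rewrite inE/= in_itv/= /uniform_pdf => /andP[u0 ux].
  by rewrite u0 (le_trans ux xa1) subr0 invr1.
rewrite integral_cst//= mul1e lebesgue_measure_itv/= lte_fin oppr0 adde0.
case: ltP => // xa; congr (_%:E); lra.
Qed.

Lemma cdf_uniform01_powR_lt0 (x : R) : x < 0 ->
  cdf (rv_powR U alpha^-1 : {RV Q >-> R}) x = 0%E.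
Proof.
move=> x0; rewrite /cdf /distribution /pushforward.
rewrite (_ : _ @^-1` _ = set0) ?measure0//.
apply/seteqP; split => w //=; rewrite in_itv/= /rv_powR => H.
by have := powR_ge0 (U w) alpha^-1; lra.
Qed.

Lemma cdf_uniform01_powR_ge1 (x : R) : 1 <= x ->
  cdf (rv_powR U alpha^-1 : {RV Q >-> R}) x = 1%E.
Proof.
move=> x1; apply/eqP; rewrite eq_le cdf_le1/=.
have <- : cdf (rv_powR U alpha^-1 : {RV Q >-> R}) 1 = 1%E.
  by rewrite cdf_uniform01_powR ?powR1// ler01 lexx.
exact: cdf_nondecreasing.
Qed.

End uniform_power.

(** * The limit of the age ratio *)

Section ratio.
Context d (T : measurableType d) (R : realType) (P : probability T R).
Variables (X : nat -> {RV P >-> R}) (alpha t0 : R) (L : R -> R).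
Hypothesis alpha01 : 0 < alpha < 1.
Hypothesis indepX : mutually_independent P X.
Hypothesis idX : identically_distributed P X.
Hypothesis X_ge0 : forall n, {ae P, forall w, 0 <= X n w}.
Hypothesis svL : slowly_varying L.
Hypothesis tailX : forall t : R, t0 < t -> ccdf (X 0%N) t =
  (\int[lebesgue_measure]_(s in `]t, +oo[) (s `^ (- alpha - 1) * L s)%:E)%E.
Local Notation law := (distribution P (X 0%N)).

Let powR_inv_opp (y : R) : 0 < y -> (y^-1) `^ (- alpha) = y `^ alpha.
Proof.
move=> y0; have y0' : 0 <= y by exact: ltW.
by rewrite -(powR_inv1 y0') -powRrM mulN1r opprK.
Qed.

(** For [a >= M] the law of the jump charges the section of [ratio_set] with
[P (X >= a / x)], which [ccdf_scale] compares with [P (X > a)]; for [0 <= a < M]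
the section of [young_set] is all of [(a, +oo)] and makes up for the
difference. *)
Lemma ratio_law_squeeze (x e : R) : 0 < x < 1 -> 0 < e < 1 ->
  exists M0 : R, forall M, M0 <= M -> forall a : R,
  (law (xsection (ratio_set x) a) <=
    (x `^ alpha + e)%:E * law (xsection (@jump_set R) a)
      + law (xsection (young_set M) a) /\
   (x `^ alpha)%:E * law (xsection (@jump_set R) a) <=
    law (xsection (ratio_set x) a)
      + (e%:E * law (xsection (@jump_set R) a)
      + law (xsection (young_set M) a)))%E.
Proof.
move=> /andP[x0 x1] /andP[e0 e1]; have [alpha0 alpha1] := andP alpha01.
have alpha_neq0 : alpha != 0 by rewrite gt_eqF.
have xa0 : 0 < x `^ alpha by exact: powR_gt0.
have powlt y z r : 0 < r -> 0 <= y -> 0 <= z -> y < z -> y `^ r < z `^ r :> R.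
  by move=> r0 y0 z0 yz; apply: gt0_ltr_powR.
have xa1 : x `^ alpha < 1.
  by have := powlt x 1 alpha alpha0 (ltW x0) ler01 x1; rewrite powR1.
(* The weak inequality [a <= x * X] is bounded above through the strict tail
   at [a / z] for some [z > x] with [z `^ alpha] close to [x `^ alpha]. *)
pose v := Num.min (x `^ alpha + e / 2) ((1 + x `^ alpha) / 2).
have xv : x `^ alpha < v by rewrite lt_min; apply/andP; split; lra.
have ve : v <= x `^ alpha + e / 2 by rewrite ge_min lexx.
have v1 : v < 1.
  by apply: (@le_lt_trans _ _ ((1 + x `^ alpha) / 2)); [rewrite ge_min lexx orbT|lra].
have v0 : 0 < v by lra.
pose z := v `^ alpha^-1.
have z0 : 0 < z by exact: powR_gt0.
have zv : z `^ alpha = v by rewrite /z -powRrM mulVf// powRr1// ltW.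
have xz : x < z.
  have -> : x = (x `^ alpha) `^ alpha^-1 by rewrite -powRrM mulfV// powRr1// ltW.
  by apply: powlt => //; [rewrite invr_gt0|exact: ltW..].
have [s2 Hs2] := @ccdf_scale _ _ _ _ _ _ _ _ svL tailX x^-1 e
  ltac:(by rewrite invr_gt0) ltac:(by rewrite e0 e1).
have [s3 Hs3] := @ccdf_scale _ _ _ _ _ _ _ _ svL tailX z^-1 (e / 2)
  ltac:(by rewrite invr_gt0) ltac:(by apply/andP; split; lra).
pose M0 := Num.max 1 (Num.max s2 s3).
have M01 : 1 <= M0 by rewrite le_max lexx.
have M0s2 : s2 <= M0 by rewrite !le_max lexx orbT.
have M0s3 : s3 <= M0 by rewrite !le_max lexx !orbT.
exists M0 => M M0M a.
have mK := @measurable_xsection _ _ _ _ _ a (measurable_ratio_set x).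
have mH := @measurable_xsection _ _ _ _ _ a (@measurable_jump_set R).
have KH : (law (xsection (ratio_set x) a) <= law (xsection (@jump_set R) a))%E.
  by apply: le_measure; rewrite ?inE// => y; rewrite /xsection/= !inE => -[].
have HE : law (xsection (@jump_set R) a) = (fine (law (xsection (@jump_set R) a)))%:E.
  by rewrite fineK// fin_num_measure.
have KE : law (xsection (ratio_set x) a) = (fine (law (xsection (ratio_set x) a)))%:E.
  by rewrite fineK// fin_num_measure.
have h0 : 0 <= fine (law (xsection (@jump_set R) a)) by rewrite fine_ge0.
have k0 : 0 <= fine (law (xsection (ratio_set x) a)) by rewrite fine_ge0.
have [aM|Ma] := ltP a M.
  have [a0|a0] := ltP a 0.
    have H0 : law (xsection (@jump_set R) a) = 0%E.
      rewrite (_ : xsection _ _ = set0) ?measure0//.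
      by apply/seteqP; split => y //; rewrite /xsection/= inE => /andP[/=]; lra.
    have K0 : law (xsection (ratio_set x) a) = 0%E.
      by apply/eqP; rewrite eq_le measure_ge0 andbT -H0.
    by rewrite H0 K0 !mule0 !add0e; split; exact: measure_ge0.
  rewrite law_xsection_young_set a0 aM/= -law_xsection_jump_set//.
  move: KH; rewrite HE KE -!EFinM -!EFinD !lee_fin => kh.
  by split; nra.
have a0 : 0 < a by lra.
rewrite law_xsection_young_set ltNge Ma andbF !adde0.
have [lo _] := Hs2 a ltac:(lra); have [_ up] := Hs3 a ltac:(lra).
have K1 : (ccdf (X 0%N) (x^-1 * a) <= law (xsection (ratio_set x) a))%E.
  apply: le_measure; rewrite ?inE// => y /=; rewrite in_itv/= andbT => xay.
  rewrite /xsection/= inE /ratio_set/= (ltW a0)/=.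
  have ax : a <= x * y by rewrite -ler_pdivrMl//; exact: ltW.
  by split => //; nra.
have K2 : (law (xsection (ratio_set x) a) <= ccdf (X 0%N) (z^-1 * a))%E.
  apply: le_measure; rewrite ?inE// => y /=; rewrite /xsection/= inE => -[/= _ axy].
  by rewrite in_itv/= andbT ltr_pdivrMl//; nra.
have ccE : ccdf (X 0%N) a = law (xsection (@jump_set R) a).
  by rewrite law_xsection_jump_set// ltW.
have {lo K1} := le_trans lo K1; have {up K2} := le_trans K2 up.
rewrite !powR_inv_opp// zv ccE HE KE -!EFinM -!EFinD !lee_fin => up lo.
split.
  have ve2 : v * (1 + e / 2) <= x `^ alpha + e by nra.
  by apply: le_trans up _; rewrite ler_wpM2r.
have xae : x `^ alpha - e <= x `^ alpha * (1 - e) by nra.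
have := ler_wpM2r h0 xae; lra.
Qed.

(** Apply the potential to [ratio_law_squeeze]: it maps the section of
[jump_set] to [1] and the section of [young_set] to [young_prob]. *)
Lemma probability_ratio_cvg (x e : R) : 0 < x < 1 -> 0 < e < 1 ->
  exists T0, forall t, T0 <= t ->
    ((x `^ alpha)%:E <= P (straddle X (ratio_set x) t) + e%:E /\
     P (straddle X (ratio_set x) t) <= (x `^ alpha + e)%:E)%E.
Proof.
move=> x01 /andP[e0 e1]; have [alpha0 alpha1] := andP alpha01.
have e2 : 0 < e / 2 < 1 by apply/andP; split; lra.
have [M0 HM0] := ratio_law_squeeze x01 e2.
have [b0 charged] := ccdf_itv_charged svL tailX.
have [b1 b10 mean] := ccdf_series_dvg svL tailX alpha1.
pose M := Num.max 1 (Num.max M0 (Num.max b0 b1)).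
have M1 : 1 <= M by rewrite le_max lexx.
have MM0 : M0 <= M by rewrite !le_max lexx orbT.
have Mb0 : b0 <= M by rewrite !le_max lexx !orbT.
have Mb1 : b1 <= M by rewrite !le_max lexx !orbT.
have tail_gt0 := ccdf_gt0 svL tailX.
have wcharged j : (0 < law
    `](2 * j%:R + 1) * M, (2 * j%:R + 2) * M]%classic%R)%E.
  have j0 : (0 : R) <= j%:R by [].
  by apply: charged; nra.
have wmean B : exists J : nat,
    (B%:E <= \sum_(j < J) ccdf (X 0%N) (3 * M * j.+1%:R))%E.
  by apply: mean; lra.
have [e20 _] := andP e2.
have [T1 HT1] := young_prob_eventually_small indepX idX X_ge0 wcharged wmean e20.
exists (Num.max 0 T1) => t tT.
have t_ge0 : 0 <= t by apply: le_trans tT; rewrite le_max lexx.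
have {HT1}young : (young_prob X M t <= (e / 2)%:E)%E.
  by apply: HT1; apply: le_trans tT; rewrite le_max lexx orbT.
have mx (D : set (R * R)) : measurable D ->
    measurable_fun setT (fun a => law (xsection D a)).
  by move=> mD; exact: measurable_fun_xsection.
have mJ := mx _ (@measurable_jump_set R).
have mK := mx _ (measurable_ratio_set x).
have mY := mx _ (measurable_young_set M).
have full : potential X (fun a => law (xsection (@jump_set R) a)) t = 1%E.
  rewrite -(probability_straddle indepX idX X_ge0)//.
    exact: probability_straddle_jump_set.
  exact: measurable_jump_set.
have KE : P (straddle X (ratio_set x) t) =
    potential X (fun a => law (xsection (ratio_set x) a)) t.
  apply: probability_straddle => //; first exact: measurable_ratio_set.
  by move=> p [].
have xa0 : 0 <= x `^ alpha by exact: powR_ge0.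
have xe0 : 0 <= x `^ alpha + e / 2 by lra.
have e20' : 0 <= e / 2 by lra.
have mrZ (r : R) (g : R -> \bar R) : measurable_fun setT g ->
    measurable_fun setT (fun a => r%:E * g a)%E.
  by move=> mg; exact: emeasurable_funM.
have r0 (r : R) (D : set (R * R)) a : 0 <= r -> (0 <= r%:E * law (xsection D a))%E.
  by move=> r0; rewrite mule_ge0.
rewrite KE; split.
- rewrite -[leLHS]mule1 -full -potentialZ//.
  apply: (@le_trans _ _ (potential X (fun a => law (xsection (ratio_set x) a)
      + ((e / 2)%:E * law (xsection (@jump_set R) a)
      + law (xsection (young_set M) a)))%E t)).
    apply: le_potential => //; first exact: mrZ.
    + by apply: emeasurable_funD => //; apply: emeasurable_funD => //; exact: mrZ.
    + by move=> a; exact: r0.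
    + by move=> a; have [] := HM0 M MM0 a.
  rewrite potentialD//; last 2 first.
  + by apply: emeasurable_funD => //; exact: mrZ.
  + by move=> a; rewrite adde_ge0// r0.
  rewrite leeD2l// potentialD//; last 2 first.
  + exact: mrZ.
  + by move=> a; exact: r0.
  rewrite potentialZ// full mule1.
  apply: (@le_trans _ _ ((e / 2)%:E + (e / 2)%:E)%E); first by rewrite leeD2l.
  by rewrite -EFinD lee_fin; lra.
- apply: (@le_trans _ _ (potential X (fun a =>
      (x `^ alpha + e / 2)%:E * law (xsection (@jump_set R) a)
      + law (xsection (young_set M) a))%E t)).
    apply: le_potential => //.
    + by apply: emeasurable_funD => //; exact: mrZ.
    + by move=> a; have [] := HM0 M MM0 a.
  rewrite potentialD//; last 2 first.
  + exact: mrZ.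
  + by move=> a; exact: r0.
  rewrite potentialZ// full mule1.
  apply: (@le_trans _ _ ((x `^ alpha + e / 2)%:E + (e / 2)%:E)%E).
    by rewrite leeD2l.
  by rewrite -EFinD lee_fin; lra.
Qed.

End ratio.

Lemma cvg_EFin_pinfty (R : realType) (f : R -> \bar R) (l : R) :
  (forall t, 0 <= f t <= 1)%E ->
  (forall e, 0 < e < 1 -> exists T0, forall t, T0 <= t ->
    (l%:E <= f t + e%:E /\ f t <= (l + e)%:E)%E) ->
  f t @[t --> +oo] --> l%:E.
Proof.
move=> f01 H.
have fE t : f t = (fine (f t))%:E.
  have /andP[f0 f1] := f01 t.
  by rewrite fineK// ge0_fin_numE// (le_lt_trans f1)// ltry.
apply/fine_cvgP; split; first by apply: nearW => t; rewrite fE.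
apply/cvgrPdist_le => e e0.
have e'01 : 0 < Num.min e 2^-1 < 1.
  rewrite lt_min e0/= invr_gt0 ltr0n/=.
  by apply: (@le_lt_trans _ _ 2^-1); [rewrite ge_min lexx orbT|lra].
have [T0 HT0] := H _ e'01.
exists T0; split; first exact: num_real.
move=> t /ltW /HT0; rewrite fE -EFinD !lee_fin => -[h1 h2].
have ee : Num.min e 2^-1 <= e by rewrite ge_min lexx.
by rewrite ler_norml; apply/andP; split; rewrite /=; lra.
Qed.

Theorem theorem1 (R : realType)
  (d : measure_display) (T : measurableType d) (P : probability T R)
  (d' : measure_display) (T' : measurableType d') (Q : probability T' R)
  (alpha : R) (X : nat -> {RV P >-> R}) (t0 : R) (L : R -> R)
  (U : {RV Q >-> R})
  (alpha01 : 0 < alpha < 1)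
  (indepX : mutually_independent P X)
  (idX : identically_distributed P X)
  (non_arithX : forall n, non_arithmetic P (X n))
  (X_ge0 : forall n, {ae P, forall w, 0 <= X n w})
  (t0_gt0 : 0 < t0)
  (svL : slowly_varying L)
  (tailX : forall (n : nat) (t : R), t0 < t ->
    P [set w | t < X n w] =
      (\int[lebesgue_measure]_(s in `]t, +oo[) (s `^ (- alpha - 1) * L s)%:E)%E)
  (unifU : uniform01 Q U) :
  cvg_in_distribution P Q (pinfty_nbhs R)
    (fun t : R => rv_div (age X t) (cycle_in_progress X t))
    (rv_powR U alpha^-1).
Proof.
have [alpha0 alpha1] := andP alpha01.
have tail0 t : t0 < t -> ccdf (X 0%N) t =
    (\int[lebesgue_measure]_(s in `]t, +oo[) (s `^ (- alpha - 1) * L s)%:E)%E.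
  move=> /(tailX 0%N) <-; rewrite /ccdf /distribution /pushforward; congr (P _).
  by apply/seteqP; split => w /=; rewrite in_itv/= andbT.
pose F x t := cdf (rv_div (age X t) (cycle_in_progress X t) : {RV P >-> R}) x.
have F01 x t : (0 <= F x t <= 1)%E by rewrite cdf_ge0 cdf_le1.
have Fnd x y t : x <= y -> (F x t <= F y t)%E.
  by move=> xy; exact: cdf_nondecreasing.
have tail_pos := ccdf_gt0 svL tail0.
have FE x t : 0 <= t -> F x t = P (straddle X (ratio_set x) t).
  by move=> t_ge0; apply: cdf_age_ratio.
have mid x e : 0 < x < 1 -> 0 < e < 1 -> exists T0, forall t, T0 <= t ->
    ((x `^ alpha)%:E <= F x t + e%:E /\ F x t <= (x `^ alpha + e)%:E)%E.
  move=> x01 e01.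
  have [T0 HT0] := probability_ratio_cvg alpha01 indepX idX X_ge0 svL tail0 x01 e01.
  exists (Num.max 0 T0) => t; rewrite ge_max => /andP[t_ge0 T0t].
  by rewrite FE//; exact: HT0.
have root (y : R) : 0 < y < 1 -> (0 < y `^ alpha^-1 < 1) /\ (y `^ alpha^-1) `^ alpha = y.
  move=> /andP[y0 y1]; split.
    rewrite powR_gt0//=; have := @gt0_ltr_powR R alpha^-1 _ y 1.
    by rewrite powR1; apply; rewrite ?invr_gt0// ?nnegrE// ltW.
  by rewrite -powRrM mulVf ?gt_eqF// powRr1// ltW.
(* For [x <= 0] and [1 <= x] the bounds come from those on [(0, 1)], because
   distribution functions are nondecreasing. *)
move=> x _.
have [x0|x0|x0] := ltgtP x 0.
- rewrite cdf_uniform01_powR_lt0//; apply: (@cvg_EFin_pinfty _ (F x) _ (F01 x)) => e /andP[e0 _].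
  exists 0 => t t_ge0; rewrite FE// (_ : straddle _ _ _ = set0).
    by rewrite measure0 add0e add0r !lee_fin ltW.
  apply/seteqP; split => w // [n _ /= [/andP[/= h1 h2] h3]].
  by have := nmulr_rlt0 (X n w) x0; nra.
- have [x1|x1] := ltP x 1.
    rewrite cdf_uniform01_powR//; last by rewrite !ltW.
    by apply: (@cvg_EFin_pinfty _ (F x) _ (F01 x)) => e e01; apply: mid => //; rewrite x0.
  rewrite cdf_uniform01_powR_ge1//.
  apply: (@cvg_EFin_pinfty _ (F x) _ (F01 x)) => e /andP[e0 e1].
  have [y01 yE] := root (1 - e / 2) ltac:(by apply/andP; split; lra).
  have [T0 HT0] := mid _ (e / 2) y01 ltac:(by apply/andP; split; lra).
  exists T0 => t /HT0[lo _]; have /andP[_ F1] := F01 x t; split; last first.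
    by apply: le_trans F1 _; rewrite lee_fin; lra.
  have Fx : (F ((1 - e / 2) `^ alpha^-1)%R t <= F x t)%E.
    by apply: Fnd; have /andP[_] := y01; lra.
  have {}lo := le_trans lo (leeD2r _ Fx).
  apply: (@le_trans _ _ ((1 - e / 2)%R%:E + (e / 2)%R%:E)%E).
    by rewrite -EFinD lee_fin; lra.
  apply: (@le_trans _ _ (F x t + (e / 2)%R%:E + (e / 2)%R%:E)%E).
    by rewrite leeD2r// -[in leLHS]yE.
  by rewrite -addeA leeD2l// -EFinD lee_fin; lra.
- rewrite {x}x0 cdf_uniform01_powR ?lexx ?ler01// powR0 ?gt_eqF//.
  apply: (@cvg_EFin_pinfty _ (F 0) _ (F01 0)) => e /andP[e0 e1].
  have [y01 yE] := root (e / 2) ltac:(by apply/andP; split; lra).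
  have [T0 HT0] := mid _ (e / 2) y01 ltac:(by apply/andP; split; lra).
  exists T0 => t /HT0[_ up]; have /andP[F0 _] := F01 0 t; split.
    by rewrite adde_ge0// lee_fin ltW.
  have Fx : (F 0%R t <= F ((e / 2) `^ alpha^-1)%R t)%E.
    by apply: Fnd; exact: powR_ge0.
  apply: (le_trans Fx); apply: le_trans up _.
  by rewrite yE lee_fin; lra.
Qed.
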